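(* Let $\lambda$ be a partition. Then $G_\lambda(x||a)=(-1)^{|\lambda|}\sum_D\mathrm{wt}(D)$, where the sum is over all $\lambda$-halfplane pipedreams $D$.
   Context: $S_\mathbb{Z}$: permutations of $\mathbb{Z}$ fixing all but finitely many integers, generated by $s_i$ exchanging $i,i+1$; $\ell$ length; $S_n\subset S_+=\langle s_i:i>0\rangle$; $\gamma(s_i)=s_{i+1}$. $a\ominus b=(a-b)/(1-b)$. $\tilde\pi_i f=\frac{(1-x_{i+1})f-(1-x_i)s_i(f)}{x_i-x_{i+1}}$. For $w\in S_n$: $\mathfrak{G}_{w_0}(x;a)=\prod_{i+j\le n}(x_i\ominus a_j)$, $\mathfrak{G}_w(x;a)=\tilde\pi_i\mathfrak{G}_{ws_i}(x;a)$ when $\ell(ws_i)>\ell(w)$. ${\overleftarrow{\mathfrak{G}}}_w(x;a)$ is the coefficientwise limit as $p\to-\infty$ of $\mathfrak{G}_{\gamma^{1-p}(w)}(x;a)$ with $x_i\mapsto x_{i+p-1}$, $a_i\mapsto a_{i+p-1}$. For a partition $\lambda$ put $s_{j-i}$ in box $(i,j)$ of its diagram; $w_\lambda$ is the product of these read from the last row to the first, each row right to left (e.g. $w_{(3,2)}=s_0s_{-1}s_2s_1s_0$). $G_\lambda(x||a)={\overleftarrow{\mathfrak{G}}}_{w_\lambda}(x;a)$. For $w\in S_\mathbb Z$, $I_{w,+}=\mathbb{Z}_{>0}\cap w(\mathbb{Z}_{\le0})$, $I_{w,-}=\mathbb{Z}_{\le0}\cap w(\mathbb{Z}_{>0})$.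 Matrix coordinates: $(i,j)$ is row $i$, column $j$, rows increasing downward. Tiles: empty, NW elbow (pipe joining north and west edges), SE elbow (joining south and east edges), horizontal, vertical, crossing. A $\lambda$-halfplane pipedream is a tiling of the upper halfplane $\mathbb{Z}_{\le0}\times\mathbb{Z}$ by these tiles, with pipe ends matching and no crossing tiles, such that (1) pipes enter from the southern boundary exactly in the columns indexed by a set $I\subset\mathbb{Z}$; (2) $I\cap\mathbb{Z}_{>0}=I_{w_\lambda,+}$ and $\mathbb{Z}_{\le0}\setminus I=I_{w_\lambda,-}$; (3) for each $i\ge1$ the $i$-th eastmost pipe entering from the south heads off to the east in row $1-i$. The weight is $\mathrm{wt}(D)=\prod_{(i,j)\ \text{empty}}(-(x_i\ominus a_j))\prod_{(i,j)\ \text{NW elbow}}(1-(x_i\ominus a_j))$.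
   Formalization: The pipedreams D are also required to have finitely many empty and NW-elbow tiles; otherwise, e.g. for λ=(1), the tiling with NW elbows at all (i,i), i≤0, is admitted and makes the identity false. Coefficientwise means in the x and a variables. *)

(* Defs.v *)
From HB Require Import structures.
From mathcomp Require Import all_boot all_order all_algebra finmap.
From mathcomp Require Import boolp classical_sets functions cardinality fsbigop.
From mathcomp.multinomials Require Import monalg.

Set Implicit Arguments.
Unset Strict Implicit.
Unset Printing Implicit Defensive.

Import Order.TTheory GRing.Theory Num.Theory.

Local Open Scope classical_set_scope.
Local Open Scope ring_scope.

(** * Formal power series in an arbitrary family of variables *)

(* [mpseries R I] is R[[ z_v : v in I ]].  A record is used because plain
   functions into R already carry the pointwise product. *)
Record mpseries (R : Type) (I : choiceType) : Type :=
  MPSeries { mpcoef :> {cmonom I} -> R }.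

Section MPSeriesRing.
Variables (R : comNzRingType) (I : choiceType).
Local Notation M := {cmonom I}.
Local Notation ser := (mpseries R I).
Implicit Types (f g h : ser) (m d e : M).

Lemma mpseriesP f g : (forall m, f m = g m) -> f = g.
Proof. by case: f g => [f] [g] /= fg; congr MPSeries; apply/funext. Qed.

HB.instance Definition _ := gen_eqMixin ser.
HB.instance Definition _ := gen_choiceMixin ser.

Definition mps_zero : ser := MPSeries (fun=> 0).
Definition mps_opp f : ser := MPSeries (fun m => - f m).
Definition mps_add f g : ser := MPSeries (fun m => f m + g m).

Fact mps_addA : associative mps_add.
Proof. by move=> f g h; apply: mpseriesP => m /=; rewrite addrA. Qed.
Fact mps_addC : commutative mps_add.
Proof. by move=> f g; apply: mpseriesP => m /=; rewrite addrC. Qed.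
Fact mps_add0 : left_id mps_zero mps_add.
Proof. by move=> f; apply: mpseriesP => m /=; rewrite add0r. Qed.
Fact mps_addN : left_inverse mps_zero mps_opp mps_add.
Proof. by move=> f; apply: mpseriesP => m /=; rewrite addNr. Qed.

HB.instance Definition _ :=
  GRing.isZmodule.Build ser mps_addA mps_addC mps_add0 mps_addN.

Definition mps_one : ser := MPSeries (fun m => (m == mone)%:R).

Definition mps_mul f g : ser := MPSeries (fun m =>
  \sum_(de \in [set de : M * M | mmul de.1 de.2 = m]) f de.1 * g de.2).

(* A finite list of monomials containing all divisors of [m]. *)
Definition cmbox m : seq M :=
  undup [seq mkcmonom [fsfun i : finsupp m => (u i : nat) | 0%N]
        | u : {ffun finsupp m -> 'I_(mdeg m).+1}].

Lemma cm_le_mdeg m i : (m i <= mdeg m)%N.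
Proof.
have [im|im] := boolP (i \in finsupp m); last first.
  by move: im; rewrite -cmE_eq0 => /eqP ->.
by rewrite mdegE (big_fsetD1 i im) /= leq_addr.
Qed.

Lemma cmbox_dvd m d : (forall i, d i <= m i)%N -> d \in cmbox m.
Proof.
move=> dm; rewrite mem_undup; apply/mapP => /=.
exists [ffun i : finsupp m => inord (d (val i))]; first by rewrite mem_enum.
apply/eqP/cmP => i; rewrite cmE fsfun_ffun.
case: insubP => [j _ <-|] /=.
  by rewrite ffunE inordK// ltnS (leq_trans (dm _))// cm_le_mdeg.
by rewrite -cmE_eq0 => /eqP mi0; have := dm i; rewrite mi0 leqn0 => /eqP.
Qed.

Lemma mps_mul_box f g m (X : seq M) : uniq X ->
  (forall d, (forall i, d i <= m i)%N -> d \in X) ->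
  mps_mul f g m =
  \sum_(d <- X) \sum_(e <- X) (f d * g e) *+ (mmul d e == m).
Proof.
move=> uX HX; rewrite /mps_mul /=.
pose Y := [seq de <- [seq (d, e) | d <- X, e <- X] | mmul de.1 de.2 == m].
have uY : uniq Y by rewrite filter_uniq// allpairs_uniq// => -[? ?] [? ?].
have -> : [set de : M * M | mmul de.1 de.2 = m] = [set` Y].
  apply/seteqP; split=> [[d e]|[d e]] /=; rewrite mem_filter /=; last first.
    by move=> /andP[/eqP].
  move=> dem; rewrite dem eqxx /=; apply/allpairsP; exists (d, e) => /=.
  by split=> //; apply: HX => i; rewrite -dem cmM ?leq_addr ?leq_addl.
rewrite -fsbig_seq// big_filter big_mkcond big_allpairs /=.
by apply: eq_bigr => d _; apply: eq_bigr => e _; case: ifP.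
Qed.

Fact mps_mulC : commutative mps_mul.
Proof.
move=> f g; apply: mpseriesP => m.
rewrite !(@mps_mul_box _ _ m (cmbox m)) ?undup_uniq//;
  try exact: cmbox_dvd.
rewrite exchange_big /=; apply: eq_bigr => d _; apply: eq_bigr => e _.
by rewrite mulrC mulmC.
Qed.

Let mul3 (X : seq M) f g h m := \sum_(a <- X) \sum_(b <- X) \sum_(c <- X)
  (f a * g b * h c) *+ (mmul (mmul a b) c == m).

Let mps_mul3 f g h m : mps_mul (mps_mul f g) h m = mul3 (cmbox m) f g h m.
Proof.
set X := cmbox m.
have uX : uniq X by exact: undup_uniq.
rewrite (@mps_mul_box _ _ m X)//; last exact: cmbox_dvd.
transitivity (\sum_(d <- X) \sum_(c <- X) \sum_(a <- X) \sum_(b <- X)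
    (f a * g b * h c) *+ ((mmul d c == m) && (mmul a b == d))).
  apply: eq_bigr => d _; apply: eq_bigr => c _.
  have [dcm|_] := eqVneq (mmul d c) m; last first.
    by rewrite /= mulr0n big1 // => a _; rewrite big1.
  rewrite mulr1n (@mps_mul_box _ _ d X)//.
    rewrite big_distrl; apply: eq_bigr => a _.
    by rewrite big_distrl; apply: eq_bigr => b _; rewrite /= mulrnAl.
  move=> e ed; apply: cmbox_dvd => i.
  by rewrite -dcm cmM (leq_trans (ed i)) ?leq_addr.
under eq_bigr do rewrite exchange_big /=.
rewrite exchange_big /=; apply: eq_bigr => a _.
under eq_bigr do rewrite exchange_big /=.
rewrite exchange_big /=; apply: eq_bigr => b _.
rewrite exchange_big /=; apply: eq_bigr => c _.
have [abcm|abcm] := eqVneq (mmul (mmul a b) c) m; last first.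
  rewrite mulr0n big1 // => d _; case: eqVneq => //= dcm; case: eqVneq => //.
  by move=> abd; rewrite abd dcm eqxx in abcm.
have abX : mmul a b \in X.
  by apply: cmbox_dvd => i; rewrite -abcm [leqRHS]cmM leq_addr.
rewrite (bigD1_seq (mmul a b))//= abcm !eqxx big1 ?addr0// => d.
by rewrite eq_sym => /negPf ->; rewrite andbF.
Qed.

Fact mps_mulA : associative mps_mul.
Proof.
move=> f g h; rewrite [LHS]mps_mulC; apply: mpseriesP => m.
rewrite !mps_mul3 /mul3.
under eq_bigr do rewrite exchange_big /=.
rewrite exchange_big /=; apply: eq_bigr => a _.
apply: eq_bigr => b _; apply: eq_bigr => c _.
by rewrite mulrC mulrA [mmul _ a]mulmC mulmA.
Qed.

Fact mps_mul1 : left_id mps_one mps_mul.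
Proof.
move=> f; apply: mpseriesP => m.
have uX : uniq (cmbox m) by exact: undup_uniq.
rewrite (@mps_mul_box _ _ m (cmbox m))//; last exact: cmbox_dvd.
have oX : mone \in cmbox m by apply: cmbox_dvd => i; rewrite cm1.
have mX : m \in cmbox m by exact: cmbox_dvd.
rewrite (bigD1_seq mone)//= [X in _ + X]big1 ?addr0; last first.
  by move=> d /negPf d1; rewrite big1// => e _; rewrite d1 mul0r mul0rn.
rewrite (bigD1_seq m)//= big1 ?addr0 ?mul1m ?eqxx ?mul1r// => e /negPf em.
by rewrite mul1m em.
Qed.

Fact mps_mulDl : left_distributive mps_mul mps_add.
Proof.
move=> f g h; apply: mpseriesP => m.
have uX : uniq (cmbox m) by exact: undup_uniq.
have E k l := @mps_mul_box k l m (cmbox m) uX (@cmbox_dvd m).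
transitivity (mps_mul f h m + mps_mul g h m) => //.
rewrite !E -big_split /=; apply: eq_bigr => d _.
by rewrite -big_split /=; apply: eq_bigr => e _; rewrite mulrDl mulrnDl.
Qed.

Fact mps_one_neq0 : mps_one != 0 :> ser.
Proof.
apply/eqP => /(congr1 (fun f : ser => f mone)) /= /eqP.
by rewrite eqxx oner_eq0.
Qed.

HB.instance Definition _ := GRing.Zmodule_isComNzRing.Build ser
  mps_mulA mps_mulC mps_mul1 mps_mulDl mps_one_neq0.

End MPSeriesRing.

Section MPSeriesOps.
Variables (R : comNzRingType) (I : choiceType).
Local Notation ser := (mpseries R I).

Definition mps_var (v : I) : ser := MPSeries (fun m => (m == ucm v)%:R).

(* The exact quotient f / g: the h with h * g = f.  It is unique for g <> 0
   when R is a domain; the default 0 is taken only if no such h exists. *)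
Definition mps_quot (f g : ser) : ser := xget 0 [set h | h * g = f].

Definition cm_map (r : I -> I) (m : {cmonom I}) : {cmonom I} :=
  \big[mmul/mone]_(v <- finsupp m) expcmn (ucm (r v)) (m v).

(* The substitution z_v |-> z_(r v), for an injective renaming r of the
   variables (the sum then has at most one term). *)
Definition mps_rename (r : I -> I) (f : ser) : ser :=
  MPSeries (fun m => \sum_(d \in [set d | cm_map r d = m]) f d).

(* Sums of possibly infinite families, taken coefficientwise. *)
Definition mps_summable (T : choiceType) (A : set T) (F : T -> ser) : Prop :=
  forall m, finite_set [set t | A t /\ F t m != 0].

Definition mps_sum (T : choiceType) (A : set T) (F : T -> ser) : ser :=
  MPSeries (fun m => \sum_(t \in A) F t m).

Definition mps_cvg_mninfty (u : int -> ser) (l : ser) : Prop :=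
  forall m, exists P : int, forall p : int, p <= P -> u p m = l m.

Definition mps_lim_mninfty (u : int -> ser) : ser :=
  xget 0 [set l | mps_cvg_mninfty u l].

End MPSeriesOps.

(** * Permutations of Z *)

(* Elements of S_Z are represented by their underlying functions, with
   product u v = u \o v. *)
Definition s_ (i : int) : int -> int :=
  fun j => if j == i then i + 1 else if j == i + 1 then i else j.

Definition wordprod (s : seq int) : int -> int :=
  foldr (fun i w => s_ i \o w) id s.

(* Coxeter length: the least size of a word in the generators s_i. *)
Definition slength (w : int -> int) : nat :=
  xget 0%N [set k | (exists2 s, size s = k & wordprod s = w) /\
                    forall s, wordprod s = w -> (k <= size s)%N].

(* gamma ^ k, for k in Z, as conjugation by the translation by k; see
   [gamma_s] and [gamma_mul]. *)
Definition gamma (k : int) (w : int -> int) : int -> int :=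
  fun j => w (j - k) + k.

Lemma gamma_s (k i : int) : gamma k (s_ i) = s_ (i + k).
Proof.
apply/funext => j; rewrite /gamma /s_ subr_eq [in RHS]addrAC subr_eq.
by case: eqP => _ //; case: eqP => _ //; rewrite subrK.
Qed.

Lemma gamma_mul (k : int) (u v : int -> int) :
  gamma k (u \o v) = gamma k u \o gamma k v.
Proof. by apply/funext => j; rewrite /gamma /= addrK. Qed.

Definition longest (n : nat) : int -> int :=
  fun j => if (1 <= j <= n%:Z) then n%:Z + 1 - j else j.

(** * Double Grothendieck polynomials *)

(* Z[[ x_i, a_i : i in Z ]], with x_i and a_i indexed by [inl i], [inr i]. *)
Notation series := (mpseries int (int + int)%type).

Definition xvar (i : int) : series := mps_var int (inl i).
Definition avar (i : int) : series := mps_var int (inr i).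

Definition ominus (f g : series) : series := mps_quot (f - g) (1 - g).

Definition swap_x (i : int) (v : int + int) : int + int :=
  match v with inl k => inl (s_ i k) | inr k => inr k end.

Definition pi_tilde (i : int) (f : series) : series :=
  mps_quot ((1 - xvar (i + 1)) * f - (1 - xvar i) * mps_rename (swap_x i) f)
           (xvar i - xvar (i + 1)).

(* [is_groth n w F]: starting from w_0 in S_n, the recursion produces F for
   w in S_n. *)
Inductive is_groth (n : nat) : (int -> int) -> series -> Prop :=
| groth_longest :
    is_groth n (longest n)
      (\prod_(1 <= i < n) \prod_(1 <= j < n | (i + j <= n)%N)
         ominus (xvar i%:Z) (avar j%:Z))
| groth_step (w : int -> int) (i : nat) (F : series) :
    (0 < i < n)%N -> (slength w < slength (w \o s_ i%:Z))%N ->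
    is_groth n (w \o s_ i%:Z) F -> is_groth n w (pi_tilde i%:Z F).

(* F depends neither on n nor on the chain from w_0 to w. *)
Definition groth (w : int -> int) : series :=
  xget 0 [set F | exists n, is_groth n w F].

Definition shift_var (k : int) (v : int + int) : int + int :=
  match v with inl i => inl (i + k) | inr i => inr (i + k) end.

Definition backstable_groth (w : int -> int) : series :=
  mps_lim_mninfty (fun p : int =>
    mps_rename (shift_var (p - 1)) (groth (gamma (1 - p) w))).

(** * Partitions *)

Definition is_partition (lam : seq nat) : bool :=
  sorted geq lam && (0%N \notin lam).

Definition part_word (lam : seq nat) : seq int :=
  flatten (rev [seq [seq (j%:Z - i%:Z : int)
                    | j <- rev (iota 1 (nth 0%N lam i.-1))]
               | i <- iota 1 (size lam)]).

Example part_word_32 : part_word [:: 3; 2]%N = [:: 0; -1; 2; 1; 0].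
Proof. by []. Qed.

Definition w_part (lam : seq nat) : int -> int := wordprod (part_word lam).

Definition G_part (lam : seq nat) : series := backstable_groth (w_part lam).

Definition I_plus (w : int -> int) : set int :=
  [set i | 0 < i] `&` w @` [set i | i <= 0].
Definition I_minus (w : int -> int) : set int :=
  [set i | i <= 0] `&` w @` [set i | 0 < i].

(** * Halfplane pipedreams *)

Variant tile := Empty | NWelbow | SEelbow | Horizontal | Vertical | Crossing.

HB.instance Definition _ := gen_eqMixin tile.
HB.instance Definition _ := gen_choiceMixin tile.

Definition north (t : tile) : bool :=
  match t with NWelbow | Vertical | Crossing => true | _ => false end.
Definition south (t : tile) : bool :=
  match t with SEelbow | Vertical | Crossing => true | _ => false end.
Definition east (t : tile) : bool :=
  match t with SEelbow | Horizontal | Crossing => true | _ => false end.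
Definition west (t : tile) : bool :=
  match t with NWelbow | Horizontal | Crossing => true | _ => false end.

(* [D k j] is the tile in row -k and column j; rows increase downward, so
   row index k.+1 lies just north of row index k. *)
Definition tiling := nat -> int -> tile.

Variant edge := FromSouth | FromWest.

(* [pipe D c k j e]: the pipe of D entering from the southern boundary in
   column c enters the cell (-k, j) through its edge e. *)
Inductive pipe (D : tiling) (c : int) : nat -> int -> edge -> Prop :=
| pipe_start : south (D 0%N c) -> pipe D c 0%N c FromSouth
| pipe_SE k j : pipe D c k j FromSouth -> D k j = SEelbow ->
    pipe D c k (j + 1) FromWest
| pipe_NW k j : pipe D c k j FromWest -> D k j = NWelbow ->
    pipe D c k.+1 j FromSouth
| pipe_up k j : pipe D c k j FromSouth ->
    D k j = Vertical \/ D k j = Crossing -> pipe D c k.+1 j FromSouth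
| pipe_right k j : pipe D c k j FromWest ->
    D k j = Horizontal \/ D k j = Crossing -> pipe D c k (j + 1) FromWest.

Definition heads_east (D : tiling) (c : int) (k : nat) : Prop :=
  exists j0 : int, forall j, j0 <= j -> pipe D c k j FromWest.

Definition entries (D : tiling) : set int := [set c | south (D 0%N c)].

(* Index k stands for i = k + 1, i.e. for row 1 - i = -k.  The last condition
   makes the weight a finite product; it excludes tilings with an infinite
   staircase of NW elbows, which otherwise satisfy all conditions (already for
   the partition (1)). *)
Record halfplane_pipedream (lam : seq nat) (D : tiling) : Prop := {
  hp_match_h : forall k j, east (D k j) = west (D k (j + 1));
  hp_match_v : forall k j, north (D k j) = south (D k.+1 j);
  hp_nocross : forall k j, D k j <> Crossing;
  hp_I_plus : entries D `&` [set c | 0 < c] = I_plus (w_part lam);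
  hp_I_minus : [set c | c <= 0] `\` entries D = I_minus (w_part lam);
  hp_east : forall (k : nat) (c : int), entries D c ->
    ([set c' | entries D c' /\ (c < c')%R] #= `I_k)%card -> heads_east D c k;
  hp_finite : finite_set
    [set kj : nat * int | D kj.1 kj.2 = Empty \/ D kj.1 kj.2 = NWelbow]
}.

Definition wt (D : tiling) : series :=
  (\big[*%R/1]_(kj \in [set kj : nat * int | D kj.1 kj.2 = Empty])
      (- ominus (xvar (- kj.1%:Z)) (avar kj.2))) *
  (\big[*%R/1]_(kj \in [set kj : nat * int | D kj.1 kj.2 = NWelbow])
      (1 - ominus (xvar (- kj.1%:Z)) (avar kj.2))).

(* Main.v *)
Require Import Defs.
From HB Require Import structures.
From mathcomp Require Import all_boot all_order all_fingroup all_algebra finmap.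
From mathcomp Require Import boolp classical_sets functions cardinality fsbigop.
From mathcomp.multinomials Require Import monalg.
From mathcomp Require Import zify ring.

Set Implicit Arguments.
Unset Strict Implicit.
Unset Printing Implicit Defensive.

Import Order.TTheory GRing.Theory Num.Theory.

Local Open Scope classical_set_scope.
Local Open Scope ring_scope.

(* Weighting the pipes row by row, a halfplane pipedream is a Gelfand-Tsetlin
   pattern: if the pipes entering row -r from the south do so in the columns
   lam_i - i - r (i = 0, 1, ...), the pipes leaving it to the north are given in
   the same way by a nu interlacing with lam.  So the sum over the pipedreams
   that are trivial north of row -m unfolds into the recursion
     Z_m(lam) = sum_nu W(lam / nu; x_m) Z_(m-1)(nu).
   On the other side, Grothendieck polynomials do not depend on the chain of
   divided differences (by the braid relations and a diamond argument), so for
   the Grassmannian permutation v of descent m one may start at the dominant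
   permutation v w_0^(m), whose polynomial is a product over its diagram, and
   antisymmetrize:
     Delta(x) G_v = det ((1 - x_j)^i [x_j | a]^(lam_i + m - i - 1)).
   Combining consecutive rows of this determinant so as to clear its last column
   gives the recursion for Z_m.  The limit is taken coefficientwise: a pipedream
   not trivial north of row -m has an empty tile far to the northwest. *)

(** * Formal power series *)

(** With y = 1 - x and b = 1 / (1 - a) one has x ominus a = 1 - y b, so an empty tile weighs -(1 - y
    b) and a NW elbow y b. This explains both the sign and W. A pipedream has |lam| empty tiles,
    whose signs give (-1)^|lam|. In rows i and i + 1 of the determinant the lengths of the factorial
    powers differ by lam_i - lam_(i+1) + 1, and their minor with the last column telescopes into one
    term for each nu_i between lam_(i+1) and lam_i, which is the weight of one pipe in one row. The
    powers (1 - x_j)^i come from the isobaric operators: antisymmetrization absorbs them only after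
    multiplication by a twist rho with y_(i+1) s_i(rho) = y_i rho. Quotients of series are chosen,
    not computed, so every division is replaced by the cancellation of a regular factor. For p = 1 -
    m with m at least the number of parts, the shifted polynomial is already (-1)^|lam| times the
    sum over the pipedreams trivial north of their m southern rows. In the limit an extra pipedream
    does not contribute to a fixed coefficient: its weight has a factor x_(-k) - a_j with both
    indices too negative to occur in the monomial. *)

(* Series are sealed: otherwise the failed unification of two of them compares
   their coefficient functions, hence monomials, which is extremely slow. *)
HB.lock Definition pvar (R : comNzRingType) (I : choiceType) (v : I) :
  mpseries R I := mps_var R v.

(** The geometric series 1 / (1 - z_v): its monomials are the powers of z_v. *)
HB.lock Definition geo (R : comNzRingType) (I : choiceType) (v : I) :
  mpseries R I := MPSeries (fun m => (finsupp m `<=` [fset v])%fset%:R).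

HB.lock Definition ren (R : comNzRingType) (I : choiceType) (r : I -> I)
  (f : mpseries R I) : mpseries R I := mps_rename r f.

Lemma lreg_prod (A : comNzRingType) (T : Type) (r : seq T) (P : pred T) (F : T -> A) :
  (forall t, P t -> GRing.lreg (F t)) -> GRing.lreg (\prod_(t <- r | P t) F t).
Proof.
move=> H; apply: (big_ind (fun x => GRing.lreg x)) => //; first exact: lreg1.
by move=> x y; apply: lregM.
Qed.

Section Series.
Variables (R : comNzRingType) (I : choiceType).
Local Notation M := {cmonom I}.
Local Notation ser := (mpseries R I).
Implicit Types (f g h : ser) (m d e : M) (v w : I).
Local Notation X := (pvar R).
Local Notation geo := (geo R).

Lemma mpcoefD f g m : (f + g) m = f m + g m. Proof. by []. Qed.
Lemma mpcoef0 m : (0 : ser) m = 0. Proof. by []. Qed.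
Lemma mpcoefN f m : (- f) m = - f m. Proof. by []. Qed.
Lemma mpcoefB f g m : (f - g) m = f m - g m. Proof. by []. Qed.
Lemma mpcoef1 m : (1 : ser) m = (m == mone)%:R. Proof. by []. Qed.

Lemma mpcoefM f g m : (f * g) m =
  \sum_(de \in [set de : M * M | mmul de.1 de.2 = m]) f de.1 * g de.2.
Proof. by []. Qed.
Lemma mpcoef_var v m : X v m = (m == ucm v)%:R.
Proof. by rewrite pvar.unlock. Qed.

Lemma mpcoef_sum (T : Type) (r : seq T) (P : pred T) (F : T -> ser) m :
  (\sum_(t <- r | P t) F t) m = \sum_(t <- r | P t) F t m.
Proof.
by apply: (big_morph (fun f : ser => f m)) => [f g|]; rewrite ?mpcoefD ?mpcoef0.
Qed.

Lemma mpcoefM_var f v m : (f * X v) (mmul m (ucm v)) = f m.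
Proof.
rewrite mpcoefM -(@fsbig_widen _ _ _ _ [set (m, ucm v)]).
- by rewrite fsbig_set1 /= mpcoef_var eqxx mulr1.
- by move=> _ ->.
- move=> [d e] /= [de ne]; rewrite mpcoef_var; case: eqVneq => [ee|]; last by rewrite mulr0.
  case: ne; rewrite ee in de *; congr pair; apply/eqP/cmP => i.
  by have /(congr1 (fun x : M => x i)) := de; rewrite !cmM => /addIn.
Qed.

Lemma mpcoefM_var0 f v m : m v = 0%N -> (f * X v) m = 0.
Proof.
move=> mv; rewrite mpcoefM fsbig1 // => -[d e] /= de; rewrite mpcoef_var.
case: eqVneq => [ee|]; last by rewrite mulr0.
by move: mv; rewrite -de ee cmM cmUU addn1.
Qed.

Lemma cmonom_divK m v : m v != 0%N -> m = mmul (divcm m (ucm v)) (ucm v).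
Proof.
move=> mv; apply/eqP/cmP => i; rewrite cmM divcmE cmU subnK //.
by case: eqVneq => // <-; rewrite lt0n.
Qed.

(** If f X_v = f X_w, the coefficient of f at m equals the one at m v / w, or is 0 when w does not
    divide m. Each such move lowers the exponent of w, so every coefficient vanishes. *)
Lemma lreg_var_sub v w : v != w -> GRing.lreg (X v - X w).
Proof.
move=> vw; apply: mulrI0_lreg => f; rewrite mulrC mulrBr => /eqP.
rewrite subr_eq0 => /eqP fvw; apply: mpseriesP => m; rewrite mpcoef0.
have [k] := ubnP (m w); elim: k m => [|k IH] m; first by rewrite ltn0.
rewrite ltnS => mk.
rewrite -(mpcoefM_var f v) fvw.
have mvw : mmul m (ucm v) w = m w by rewrite cmM cmU (negPf vw) addn0.
have [mw0|mw] := eqVneq (m w) 0%N; first by rewrite mpcoefM_var0 ?mvw.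
rewrite {1}(cmonom_divK mw) -mulmA [mmul (ucm w) _]mulmC mulmA mpcoefM_var.
apply: IH; rewrite cmM cmU (negPf vw) addn0 divcmE cmUU subn1.
by move: mw mk; case: (m w) => [|n].
Qed.

Lemma mpcoef_geo v m : geo v m = (finsupp m `<=` [fset v])%fset%:R.
Proof. by rewrite geo.unlock. Qed.

Lemma finsupp_mul_ucm m v :
  (finsupp (mmul m (ucm v)) `<=` [fset v])%fset = (finsupp m `<=` [fset v])%fset.
Proof.
apply/fsubsetP/fsubsetP => s w; rewrite -cmE_neq0 => mw; last first.
  have [->|wv] := eqVneq w v; first by rewrite inE.
  by apply: s; rewrite -cmE_neq0; move: mw; rewrite cmM cmU [v == w]eq_sym (negPf wv) addn0.
by apply: s; rewrite -cmE_neq0 cmM -lt0n addn_gt0 lt0n mw.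
Qed.

Lemma geoK v : geo v * (1 - X v) = 1.
Proof.
rewrite mulrBr mulr1; apply: mpseriesP => m; rewrite mpcoefB mpcoef1.
have [mv0|mv] := eqVneq (m v) 0%N.
  rewrite mpcoefM_var0 // subr0 mpcoef_geo; congr (_ %:R); congr nat_of_bool.
  apply/fsubsetP/eqP => [s|->]; last by move=> i; rewrite mdom1 inE.
  apply/eqP/cmP => i; rewrite cm1; apply/eqP; rewrite cmE_eq0.
  apply/negP => im; have := s _ im; rewrite inE => /eqP iv.
  by move: im; rewrite -cmE_neq0 iv mv0.
rewrite (cmonom_divK mv) mpcoefM_var !mpcoef_geo finsupp_mul_ucm subrr.
case: eqP => // /(congr1 (fun x : M => x v)); by rewrite cmM cmUU cm1 addn1.
Qed.

Lemma geo_uniq v g : g * (1 - X v) = 1 -> g = geo v.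
Proof.
by move=> gK; rewrite -[g]mulr1 -(geoK v) [geo v * _]mulrC mulrA gK mul1r.
Qed.

Lemma lreg_inv f g : f * g = 1 -> GRing.lreg g.
Proof. by move=> fg h k /(congr1 ( *%R f)); rewrite !mulrA fg !mul1r. Qed.

Lemma lreg_geo v : GRing.lreg (geo v).
Proof. by apply: (@lreg_inv (1 - X v)); rewrite mulrC geoK. Qed.

Lemma lreg_1sub_var v : GRing.lreg (1 - X v).
Proof. exact: lreg_inv (geoK v). Qed.

(** Regularity of g makes the chosen quotient unique; this is how all quotients are evaluated
    below. *)
Lemma mps_quotE f g h : GRing.lreg g -> h * g = f -> mps_quot f g = h.
Proof.
move=> rg hg; rewrite /mps_quot; case: xgetP => [k _ /= kg|/(_ h)//].
by apply: rg; rewrite mulrC kg -hg mulrC.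
Qed.

(** * Renaming of variables along a bijection *)

Section Rename.
Implicit Types r q : I -> I.

Lemma cm_bigE (T : Type) (s : seq T) (F : T -> M) i :
  (\big[mmul/mone]_(t <- s) F t) i = (\sum_(t <- s) F t i)%N.
Proof. by apply: (big_morph (fun m : M => m i)) => [a b|]; rewrite ?cmM ?cm1. Qed.

Lemma expcmn_ucm v k i : expcmn (ucm v) k i = (k * (v == i))%N.
Proof.
case: k => [|k]; first by rewrite /= cm1.
rewrite /expcmn iteropS; elim: k => [|k IH]; first by rewrite cmU mul1n.
by rewrite iterS -[mulcm _ _]/(mmul _ _) cmM IH cmU mulSn.
Qed.

Lemma cm_mapE r r' m i : cancel r r' -> cancel r' r -> cm_map r m i = m (r' i).
Proof.
move=> rK r'K; rewrite /cm_map cm_bigE.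
have eqE v : (r v == i) = (v == r' i) by rewrite -(can_eq r'K) rK.
under eq_bigr => v _ do rewrite expcmn_ucm eqE.
have [im|im] := boolP (r' i \in finsupp m).
  rewrite (big_fsetD1 _ im) /= eqxx muln1 big1_fset ?addn0 // => v.
  by rewrite !inE => /andP[/negPf -> _]; rewrite muln0.
rewrite big1_fset => [|v vm _]; last first.
  by case: eqP => [vi|]; [rewrite vi (negPf im) in vm|rewrite muln0].
by move: im; rewrite -cmE_eq0 => /eqP.
Qed.

Lemma renE r r' f m : cancel r r' -> cancel r' r ->
  ren r f m = f (cm_map r' m).
Proof.
move=> rK r'K; rewrite ren.unlock /=.
have -> : [set d | cm_map r d = m] = [set cm_map r' m].
  apply/seteqP; split=> d /=; last move=> ->.
    by move=> <-; apply/eqP/cmP => i; rewrite (cm_mapE _ _ r'K rK) (cm_mapE _ _ rK r'K) rK.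
  by apply/eqP/cmP => i; rewrite (cm_mapE _ _ rK r'K) (cm_mapE _ _ r'K rK) r'K.
by rewrite fsbig_set1.
Qed.

Lemma renD r f g : bijective r ->
  ren r (f + g) = ren r f + ren r g.
Proof.
case=> r' rK r'K; apply: mpseriesP => m.
by rewrite mpcoefD !(renE _ _ rK r'K).
Qed.

Lemma renN r f : bijective r -> ren r (- f) = - ren r f.
Proof.
case=> r' rK r'K; apply: mpseriesP => m.
by rewrite mpcoefN !(renE _ _ rK r'K).
Qed.

Lemma renB r f g : bijective r ->
  ren r (f - g) = ren r f - ren r g.
Proof. by move=> rb; rewrite renD ?renN. Qed.

Lemma ren0 r : bijective r -> ren r 0 = 0 :> ser.
Proof. by move=> rb; have := renB 0 0 rb; rewrite !subrr. Qed.

Lemma ren_var r v : bijective r -> ren r (X v) = X (r v).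
Proof.
case=> r' rK r'K; apply: mpseriesP => m; rewrite (renE _ _ rK r'K) !mpcoef_var.
congr (_%:R); congr nat_of_bool; apply/cmP/cmP => H i.
  by rewrite cmU -[i]r'K (can_eq rK) -cmU -H (cm_mapE _ _ r'K rK).
by rewrite (cm_mapE _ _ r'K rK) H !cmU (can_eq rK).
Qed.

Lemma ren1 r : bijective r -> ren r 1 = 1 :> ser.
Proof.
case=> r' rK r'K; apply: mpseriesP => m; rewrite (renE _ _ rK r'K) !mpcoef1.
congr (_%:R); congr nat_of_bool; apply/cmP/cmP => H i.
  by rewrite cm1 -[i]r'K -(cm_mapE _ _ r'K rK) H cm1.
by rewrite (cm_mapE _ _ r'K rK) H !cm1.
Qed.

Lemma renM r f g : bijective r ->
  ren r (f * g) = ren r f * ren r g.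
Proof.
case=> r' rK r'K; apply: mpseriesP => m; rewrite (renE _ _ rK r'K).
have mapK q q' d : cancel q q' -> cancel q' q -> cm_map q (cm_map q' d) = d.
  move=> qK q'K; apply/eqP/cmP => i.
  by rewrite (cm_mapE _ _ qK q'K) (cm_mapE _ _ q'K qK) q'K.
have mapM q q' d e : cancel q q' -> cancel q' q ->
    cm_map q (mmul d e) = mmul (cm_map q d) (cm_map q e).
  by move=> qK q'K; apply/eqP/cmP => i; rewrite !(cmM, cm_mapE _ _ qK q'K).
rewrite !mpcoefM.
rewrite (@reindex_fsbig _ _ _ _ _ (fun de : M * M => (cm_map r' de.1, cm_map r' de.2))
  [set de : M * M | mmul de.1 de.2 = m]); last first.
  split=> [[d e] /= <-|[d e] [d2 e2] _ _ /= [/(congr1 (cm_map r)) dd]|[d e] /= de].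
  - by rewrite (mapM _ _ _ _ r'K rK).
  - move/(congr1 (cm_map r)); rewrite !(mapK _ _ _ rK r'K) in dd *.
    by move=> ->; rewrite dd.
  - exists (cm_map r d, cm_map r e); last by rewrite /= !(mapK _ _ _ r'K rK).
    by rewrite /= -(mapM _ _ _ _ rK r'K) de (mapK _ _ _ rK r'K).
apply: eq_fsbigr => -[d e] _ /=.
by rewrite -!(renE _ _ rK r'K).
Qed.

Lemma renX r f n : bijective r ->
  ren r (f ^+ n) = ren r f ^+ n.
Proof.
move=> rb; elim: n => [|n IH]; first by rewrite !expr0 ren1.
by rewrite !exprS renM ?IH.
Qed.

Lemma ren_prod r (T : Type) (s : seq T) (P : pred T) (F : T -> ser) :
  bijective r ->
  ren r (\prod_(t <- s | P t) F t) = \prod_(t <- s | P t) ren r (F t).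
Proof.
move=> rb; apply: (big_morph (ren r)); last exact: ren1.
by move=> f g; apply: renM.
Qed.

Lemma ren_sum r (T : Type) (s : seq T) (P : pred T) (F : T -> ser) :
  bijective r ->
  ren r (\sum_(t <- s | P t) F t) = \sum_(t <- s | P t) ren r (F t).
Proof.
move=> rb; apply: (big_morph (ren r)); last exact: ren0.
by move=> f g; apply: renD.
Qed.

Lemma ren_comp r q f : bijective r -> bijective q ->
  ren r (ren q f) = ren (r \o q) f.
Proof.
case=> r' rK r'K [q' qK q'K]; apply: mpseriesP => m.
rewrite (renE _ _ rK r'K) (renE _ _ qK q'K).
rewrite (renE _ _ (can_comp rK qK) (can_comp q'K r'K)).
congr (f _); apply/eqP/cmP => i; rewrite (cm_mapE _ _ q'K qK) (cm_mapE _ _ r'K rK).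
by rewrite (cm_mapE _ _ (can_comp q'K r'K) (can_comp rK qK)).
Qed.

Lemma ren_id f : ren id f = f.
Proof.
apply: mpseriesP => m; rewrite (@renE id id) //; congr (f _).
by apply/eqP/cmP => i; rewrite (@cm_mapE id id).
Qed.

Lemma ren_geo r v : bijective r -> ren r (geo v) = geo (r v).
Proof.
move=> rb; apply: geo_uniq; rewrite -(ren_var v rb) -(ren1 rb).
by rewrite -renB // -renM // geoK.
Qed.

End Rename.
End Series.

Notation ainv j := (geo int (inr j : (int + int)%type)).
Notation xv i := (pvar int (inl i : (int + int)%type)).
Notation av i := (pvar int (inr i : (int + int)%type)).
(** The series x_i ominus a_j in the form 1 - y b, where y = 1 - x_i and b = 1 / (1 - a_j). *)
Notation omx i j := (1 - (1 - xv i) * ainv j).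

Lemma xvarE i : xvar i = xv i. Proof. by rewrite pvar.unlock. Qed.
Lemma avarE i : avar i = av i. Proof. by rewrite pvar.unlock. Qed.

Lemma ominusE i j : ominus (xvar i) (avar j) = omx i j.
Proof.
rewrite xvarE avarE; apply: mps_quotE; first exact: lreg_1sub_var.
rewrite mulrBl mul1r -mulrA geoK mulr1; ring.
Qed.

Lemma omx_fact i j : omx i j = (xv i - av j) * ainv j.
Proof. by rewrite -[X in X - _](geoK _ (inr j)); ring. Qed.

Lemma lreg_omx i j : GRing.lreg (omx i j).
Proof. by rewrite omx_fact; apply: lregM; [apply: lreg_var_sub|apply: lreg_geo]. Qed.

Lemma lreg_xsub i j : i != j -> GRing.lreg (xv i - xv j).
Proof. by move=> ij; apply: lreg_var_sub; apply: contra_neq ij => -[]. Qed.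

(** * Words in the simple reflections *)

Lemma s_l i : s_ i i = i + 1. Proof. by rewrite /s_ eqxx. Qed.
Lemma s_r i : s_ i (i + 1) = i.
Proof. by rewrite /s_ eqxx; case: eqP => // h; lia. Qed.
Lemma s_ne i j : j != i -> j != i + 1 -> s_ i j = j.
Proof. by rewrite /s_ => /negPf -> /negPf ->. Qed.

Lemma s_K i : involutive (s_ i).
Proof.
move=> j; have [->|ji] := eqVneq j i; first by rewrite s_l s_r.
have [->|ji1] := eqVneq j (i + 1); first by rewrite s_r s_l.
by rewrite !s_ne.
Qed.

Lemma s_inj i : injective (s_ i). Proof. exact: inv_inj (s_K i). Qed.

Lemma comp_sK (w : int -> int) i : (w \o s_ i) \o s_ i = w.
Proof. by apply/funext => j; rewrite /= s_K. Qed.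

Lemma wordprod_cat s t : wordprod (s ++ t) = wordprod s \o wordprod t.
Proof. by elim: s => //= i s ->. Qed.

Lemma wordprod_revK s : cancel (wordprod (rev s)) (wordprod s).
Proof.
elim: s => [|i s IH] j //; rewrite rev_cons -cats1 wordprod_cat /=.
by rewrite IH s_K.
Qed.

Lemma wordprodK s : cancel (wordprod s) (wordprod (rev s)).
Proof. by move=> j; have := wordprod_revK (rev s) j; rewrite revK. Qed.

Lemma wordprod_bij s : bijective (wordprod s).
Proof. exact: Bijective (@wordprodK s) (@wordprod_revK s). Qed.

Lemma wordprod_inj s : injective (wordprod s).
Proof. exact: can_inj (@wordprodK s). Qed.

(** * Lengths and descents *)

(** The exchange condition. Either the tail of the word already has the descent, and a letter is
    deleted there, or the first letter c creates it. Then the tail takes the values c and c + 1 at a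
    and a + 1, and multiplying by s_a on the right amounts to deleting c. *)
Lemma exchange s a : wordprod s (a + 1) < wordprod s a ->
  exists2 s', (size s').+1 = size s & wordprod s' = wordprod s \o s_ a.
Proof.
elim: s => [|c t IH] /=; first by lia.
have uI := @wordprod_inj t; set u := wordprod t in IH uI *.
have [lt|gt] := ltP (u (a + 1)) (u a).
  by case: (IH lt) => s' ss' ws' _; exists (c :: s') => /=; rewrite ?ss' // ws'.
have ne : u a != u (a + 1) by apply/eqP => /uI; lia.
move=> rev; have [ua ua1] : u a = c /\ u (a + 1) = c + 1.
  by move: rev; rewrite /s_; do !case: eqP => ?; lia.
exists t => //; apply/funext => j; rewrite /= -/u.
have [->|ja] := eqVneq j a; first by rewrite s_l ua1 s_r.
have [->|ja1] := eqVneq j (a + 1); first by rewrite s_r ua s_l.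
rewrite (s_ne ja ja1) s_ne //; apply/eqP.
  by rewrite -ua => /uI /eqP; rewrite (negPf ja).
by rewrite -ua1 => /uI /eqP; rewrite (negPf ja1).
Qed.

Definition isword (w : int -> int) := exists s, wordprod s = w.

Lemma isword_s w i : isword w -> isword (w \o s_ i).
Proof. by case=> s <-; exists (s ++ [:: i]); rewrite wordprod_cat. Qed.

Lemma slengthP w : isword w ->
  (exists2 s, size s = slength w & wordprod s = w) /\
  forall s, wordprod s = w -> (slength w <= size s)%N.
Proof.
case=> s0 s0w; rewrite /slength; case: xgetP => [k _ //|no].
pose P := [pred k | `[< exists2 s, size s = k & wordprod s = w >]].
have exP : exists k, P k by exists (size s0); apply/asboolP; exists s0.
case: (ex_minnP exP) => k /asboolP kP kmin; case: (no k); split=> // s sw.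
by apply: kmin; apply/asboolP; exists s.
Qed.

Lemma slength_ascent w i : isword w -> w i < w (i + 1) ->
  (slength w < slength (w \o s_ i))%N.
Proof.
move=> ww asc; have [[s <- sw] _] := slengthP (isword_s i ww).
case: (@exchange s i); first by rewrite sw /= s_l s_r.
move=> s' <-; rewrite sw comp_sK => s'w.
by rewrite ltnS; case: (slengthP ww) => _; apply.
Qed.

Lemma slength_ascentE w i : isword w ->
  (slength w < slength (w \o s_ i))%N -> w i < w (i + 1).
Proof.
move=> ww lt; have [//|ge] := ltP (w i) (w (i + 1)).
have ne : w (i + 1) != w i.
  by case: ww => s <-; apply/eqP => /(@wordprod_inj s); lia.
have := @slength_ascent (w \o s_ i) i (isword_s i ww).
rewrite comp_sK /= s_l s_r => H; have := H; move: lt; lia.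
Qed.

(** * The symmetric groups S_n inside S_Z *)

Definition inS (n : nat) (w : int -> int) :=
  injective w /\ forall j, ~~ (1 <= j <= n%:Z) -> w j = j.

Lemma inS_range n w j : inS n w -> 1 <= j <= n%:Z -> 1 <= w j <= n%:Z.
Proof.
move=> [wI wf] jn; apply: contraT => out; have := wf _ out.
by move/wI => wj; rewrite wj jn in out.
Qed.

Lemma inS_id n : inS n id. Proof. by split. Qed.

Lemma inS_comp n u v : inS n u -> inS n v -> inS n (u \o v).
Proof.
move=> [uI uf] [vI vf]; split=> [|j jn /=]; first exact: inj_comp.
by rewrite vf // uf.
Qed.

Lemma inS_s n i : 0 < i < n%:Z -> inS n (s_ i).
Proof.
move=> i_n; split=> [|j jn]; first exact: s_inj.
by rewrite s_ne //; apply/eqP => ji; move: jn; lia.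
Qed.

Lemma inS_sub m n w : (m <= n)%N -> inS m w -> inS n w.
Proof. by move=> mn [wI wf]; split=> // j jn; apply: wf; move: jn; lia. Qed.

Lemma inS_longest n : inS n (longest n).
Proof.
split=> [j k|j /negPf h]; last by rewrite /longest h.
by rewrite /longest; case: ifP; case: ifP; lia.
Qed.

(** Strict decrease bounds the values from above starting at the left end and from below starting at
    the right end, and the two bounds coincide. *)
Lemma decreasing_longest n w : inS n w ->
  (forall i : nat, (0 < i < n)%N -> w (i%:Z + 1) < w i%:Z) -> w = longest n.
Proof.
move=> wS dec; apply/funext => j; rewrite /longest; case: ifP => jn; last first.
  by case: wS => _ -> //; rewrite jn.
have ub (k : nat) : (0 < k <= n)%N -> w k%:Z <= n%:Z + 1 - k%:Z.
  elim: k => [|k IH] // kn; have [k0|k0] := posnP k.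
    have : 1 <= w 1%N%:Z <= n%:Z by apply: inS_range => //; lia.
    rewrite k0; lia.
  have := dec k; rewrite k0; have := IH.
  have -> : k.+1%:Z = k%:Z + 1 by lia.
  lia.
have lb (t : nat) : (t < n)%N -> t%:Z + 1 <= w (n%:Z - t%:Z).
  elim: t => [|t IH] tn; first by have := @inS_range n w n%:Z wS; rewrite subr0; lia.
  have := dec (n - t.+1)%N; have := IH.
  have -> : (n - t.+1)%N%:Z + 1 = n%:Z - t%:Z by lia.
  have -> : (n - t.+1)%N%:Z = n%:Z - t.+1%:Z by lia.
  lia.
case: j jn => // j jn; have := ub j; have := lb (n - j)%N.
have -> : n%:Z - (n - j)%N%:Z = j%:Z by lia.
lia.
Qed.

(** The rearrangement sum of i w(i) strictly drops when the values at an ascent are exchanged. It is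
    the termination measure for climbing to the longest element. *)
Definition muterm (w : int -> int) (i : nat) : nat := i * `|w i%:Z|%N.
Definition mu n (w : int -> int) : nat := \sum_(1 <= i < n.+1) muterm w i.

Lemma mu_ascent n w (i : nat) : inS n w -> (0 < i < n)%N ->
  w i%:Z < w (i%:Z + 1) -> (mu n (w \o s_ i%:Z) < mu n w)%N.
Proof.
move=> wS i_n asc; rewrite /mu.
have i1 : i \in index_iota 1 n.+1 by rewrite mem_index_iota; lia.
have i2 : i.+1 \in index_iota 1 n.+1 by rewrite mem_index_iota; lia.
have ne : i.+1 != i by lia.
have U := iota_uniq 1 (n.+1 - 1).
rewrite !(bigD1_seq i i1 U) /= -!(big_filter _ (fun k => k != i)).
have j2 : i.+1 \in [seq k <- index_iota 1 n.+1 | k != i].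
  by rewrite mem_filter ne.
have V : uniq [seq k <- index_iota 1 n.+1 | k != i] by rewrite filter_uniq.
rewrite !(bigD1_seq i.+1 j2 V) /=.
rewrite big_seq_cond [X in (_ < _ + (_ + X))%N]big_seq_cond.
have -> : (\sum_(k <- [seq k <- index_iota 1 n.+1 | k != i] | (k \in [seq k <- index_iota 1 n.+1 | k != i]) && (k != i.+1)) muterm (w \o s_ i) k)%N =
  (\sum_(k <- [seq k <- index_iota 1 n.+1 | k != i] | (k \in [seq k <- index_iota 1 n.+1 | k != i]) && (k != i.+1)) muterm w k)%N.
  apply: eq_bigr => k /andP[]; rewrite mem_filter => /andP[ki _] ki1.
  by rewrite /muterm /= s_ne //; lia.
have c (k : int) : (w \o s_ i) k = w (s_ i k) by [].
rewrite /muterm !c.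
have -> : i.+1%:Z = i%:Z + 1 by lia.
rewrite s_l s_r !mulSn; move: (\sum_(_ <- _ | _) _)%N => S.
have := @inS_range n w i wS; have := @inS_range n w (i%:Z + 1) wS.
move: asc; case: (w i) => a; case: (w (i%:Z + 1)) => b asc; lia.
Qed.

(** Induction down the right weak order from w_0: an element of S_n other than w_0 has an ascent,
    and exchanging the values there lowers [mu]. *)
Lemma climb_ind n (P : (int -> int) -> Prop) : P (longest n) ->
  (forall w (i : nat), inS n w -> (0 < i < n)%N -> w i%:Z < w (i%:Z + 1) ->
     P (w \o s_ i%:Z) -> P w) ->
  forall w, inS n w -> P w.
Proof.
move=> P0 PS w; have [k] := ubnP (mu n w); elim: k w => // k IH w wk wS.
case: (pselect (exists2 i : nat, (0 < i < n)%N & w i%:Z < w (i%:Z + 1))).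
  move=> [i i_n asc]; apply: (PS _ i) => //; apply: IH.
    exact: leq_trans (mu_ascent wS i_n asc) _.
  by apply: inS_comp => //; apply: inS_s; lia.
move=> no; rewrite (@decreasing_longest n w) // => i i_n.
have := wS.1; have [//|ge] := ltP (w (i%:Z + 1)) (w i) => wI.
case: no; exists i => //; rewrite lt_neqAle ge andbT.
by apply/eqP => /wI; lia.
Qed.

Lemma inS_climb n w : inS n w ->
  exists2 s, all (fun i => 0 < i < n%:Z) s & w \o wordprod s = longest n.
Proof.
move: w; apply: climb_ind => [|w i wS i_n asc [s sn sw]]; first by exists [::].
by exists (i%:Z :: s) => //=; rewrite sn andbT; lia.
Qed.

Lemma inS_word n w : inS n w ->
  exists2 s, all (fun i => 0 < i < n%:Z) s & wordprod s = w.
Proof.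
move=> wS; have [s sn ws] := inS_climb wS.
(* Climbing from the identity writes w_0 itself as a word t, and w = w_0 s^-1 then becomes a
   word. *)
have [t tn wt] := inS_climb (@inS_id n).
exists (t ++ rev s); first by rewrite all_cat tn all_rev.
rewrite wordprod_cat; apply/funext => j /=.
have := congr1 (@^~ (wordprod (rev s) j)) wt => /= ->.
by rewrite -ws /= wordprod_revK.
Qed.

Lemma inS_isword n w : inS n w -> isword w.
Proof. by case/inS_word => s _ <-; exists s. Qed.

(** * The Grassmannian permutation of a partition *)

Lemma iota_rcons m n : iota m n.+1 = rcons (iota m n) (m + n).
Proof. by rewrite -cats1 -addn1 iotaD. Qed.

Definition row_word (i : int) (l : nat) : seq int :=
  [seq j%:Z - i | j : nat <- rev (iota 1 l)].

Lemma row_wordE i l j : wordprod (row_word i l) j =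
  if j == 1 - i then l%:Z + 1 - i
  else if 1 - i < j <= l%:Z + 1 - i then j - 1 else j.
Proof.
elim: l => [|l IH]; first by rewrite /=; case: eqP => [->|_]; [lia|case: ifP; lia].
rewrite /row_word iota_rcons rev_rcons /= -/(row_word i l) IH /s_.
case: (j =P 1 - i) => [_|ji]; first by do ![case: eqP => ? | case: ifP => ?]; lia.
by have [h|h] := boolP (1 - i < j <= l%:Z + 1 - i); do ?case: ifP => ?; lia.
Qed.

Lemma nth_partition_le lam i : is_partition lam ->
  (nth 0%N lam i.+1 <= nth 0%N lam i)%N.
Proof.
move=> /andP[srt _]; have [il|il] := ltnP i.+1 (size lam).
  by have /(sortedP 0%N)/(_ i il) := srt.
by rewrite nth_default.
Qed.

Lemma nth_partition_anti lam i j : is_partition lam -> (i <= j)%N ->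
  (nth 0%N lam j <= nth 0%N lam i)%N.
Proof.
move=> lp /subnK <-; elim: (j - i)%N => //= k IH.
exact: leq_trans (nth_partition_le _ lp) IH.
Qed.

Section GrassmannianPermutation.
Variables (lam : seq nat) (lam_part : is_partition lam).
Local Notation l i := (nth 0%N lam i).

Let rows k := flatten (rev [seq row_word i%:Z (l i.-1) | i <- iota 1 k]).

Let rowsS k : wordprod (rows k.+1) = wordprod (row_word k.+1%:Z (l k)) \o wordprod (rows k).
Proof.
by rewrite /rows iota_rcons map_rcons rev_rcons /= wordprod_cat.
Qed.

(** Row k + 1 acts last, as a cycle carrying the value -k, fixed until then, to l_k - k; the cycle
    is increasing on the other integers. The values l_i - i with i < k lie above its range. Ascents
    at positive positions survive because no positive position takes the value -k. *)
Let rowsP k : [/\ forall i : nat, (i < k)%N -> wordprod (rows k) (- i%:Z) = (l i)%:Z - i%:Z,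
  forall j, j <= - k%:Z -> wordprod (rows k) j = j,
  forall j, (l 0)%:Z < j -> wordprod (rows k) j = j &
  forall j, 0 < j -> wordprod (rows k) j < wordprod (rows k) (j + 1)].
Proof.
elim: k => [|k [H1 H2 H3 H4]]; first by split=> // j _; rewrite /=; lia.
rewrite rowsS; split=> [i|j|j|j] h /=.
- move: h; rewrite ltnS leq_eqVlt => /orP[/eqP ->|h].
    by rewrite H2 // row_wordE; do ![case: eqP => ? | case: ifP => ?]; lia.
  rewrite H1 // row_wordE; have := nth_partition_anti lam_part h.
  by have := nth_partition_le i lam_part; do ![case: eqP => ? | case: ifP => ?]; lia.
- by rewrite H2 ?row_wordE; [do ![case: eqP => ? | case: ifP => ?]|]; lia.
- rewrite H3 // row_wordE; have := nth_partition_anti lam_part (leq0n k).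
  by do ![case: eqP => ? | case: ifP => ?]; lia.
- have := H4 j h; have := @wordprod_inj (rows k).
  have e : wordprod (rows k) (- k%:Z) = - k%:Z by apply: H2.
  move=> I; have n1 : wordprod (rows k) j != - k%:Z by apply/eqP; rewrite -[X in _ = X]e => /I; lia.
  have n2 : wordprod (rows k) (j + 1) != - k%:Z by apply/eqP; rewrite -[X in _ = X]e => /I; lia.
  by rewrite !row_wordE; do ![case: eqP => ? | case: ifP => ?]; lia.
Qed.

Let w_partE : w_part lam = wordprod (rows (size lam)).
Proof. by []. Qed.

Lemma w_part_bij : bijective (w_part lam). Proof. exact: wordprod_bij. Qed.

Lemma w_part_opp (i : nat) : w_part lam (- i%:Z) = (l i)%:Z - i%:Z.
Proof.
rewrite w_partE; case: (rowsP (size lam)) => H1 H2 _ _.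
have [h|h] := ltnP i (size lam); first exact: H1.
by rewrite H2 ?nth_default //; lia.
Qed.

Lemma w_part_large j : (l 0)%:Z < j -> w_part lam j = j.
Proof. by case: (rowsP (size lam)) => _ _ H _; apply: H. Qed.

Lemma w_part_ascent j : 0 < j -> w_part lam j < w_part lam (j + 1).
Proof. by case: (rowsP (size lam)) => _ _ _ H; apply: H. Qed.

End GrassmannianPermutation.

(** * Isobaric divided differences *)

Definition xmap (r : int -> int) (v : int + int) : int + int :=
  match v with inl k => inl (r k) | inr k => inr k end.

Notation xren r := (ren (xmap r)).

Lemma swap_xE i : swap_x i = xmap (s_ i).
Proof. by apply/funext => -[]. Qed.

Lemma xmap_bij r : bijective r -> bijective (xmap r).
Proof.
by case=> r' rK r'K; exists (xmap r') => -[k|k] //=; rewrite ?rK ?r'K.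
Qed.

Lemma s_bij i : bijective (s_ i). Proof. exact: inv_bij (s_K i). Qed.

Lemma xmap_s_bij i : bijective (xmap (s_ i)).
Proof. exact: xmap_bij (s_bij i). Qed.
#[local] Hint Resolve s_bij xmap_s_bij : core.

Lemma xren_x r k : bijective r -> xren r (xv k) = xv (r k).
Proof. by move=> rb; rewrite ren_var //; apply: xmap_bij. Qed.

Lemma xren_ainv r k : bijective r -> xren r (ainv k) = ainv k.
Proof. by move=> rb; rewrite ren_geo //; apply: xmap_bij. Qed.

Lemma xren_omx r i j : bijective r -> xren r (omx i j) = omx (r i) j.
Proof.
move=> rb; have b := xmap_bij rb.
by rewrite renB // renM // renB // ren1 // xren_x // xren_ainv.
Qed.

Lemma xren_comp r q (f : series) : bijective r -> bijective q ->
  xren r (xren q f) = xren (r \o q) f.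
Proof.
move=> rb qb; rewrite ren_comp; try exact: xmap_bij.
by congr (ren _ f); apply/funext => -[].
Qed.

Lemma xren_id (f : series) : xren id f = f.
Proof. by rewrite -[RHS]ren_id; congr (ren _ f); apply/funext => -[]. Qed.

Lemma xren_sK i (f : series) : xren (s_ i) (xren (s_ i) f) = f.
Proof.
rewrite xren_comp // -[RHS]xren_id; congr (ren (xmap _) f).
by apply/funext => j /=; rewrite s_K.
Qed.

(* The series on which the divided differences are defined and which they
   preserve. *)
Inductive nice : series -> Prop :=
| nice_x k : nice (xv k)
| nice_ainv k : nice (ainv k)
| nice_1 : nice 1
| nice_N f : nice f -> nice (- f)
| nice_D f g : nice f -> nice g -> nice (f + g)
| nice_M f g : nice f -> nice g -> nice (f * g).

Lemma nice_B f g : nice f -> nice g -> nice (f - g).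
Proof. by move=> nf ng; apply: nice_D => //; apply: nice_N. Qed.

Lemma nice_0 : nice 0.
Proof. by rewrite -(subrr 1); apply: nice_B; exact: nice_1. Qed.

Lemma nice_omx i j : nice (omx i j).
Proof.
apply: nice_B; first exact: nice_1.
apply: nice_M; last exact: nice_ainv.
by apply: nice_B; [exact: nice_1|exact: nice_x].
Qed.

Lemma nice_prod (T : Type) (r : seq T) (P : pred T) (F : T -> series) :
  (forall t, P t -> nice (F t)) -> nice (\prod_(t <- r | P t) F t).
Proof.
by move=> H; apply: big_ind => //; [exact: nice_1|move=> x y; exact: nice_M].
Qed.

Lemma nice_xren r f : bijective r -> nice f -> nice (xren r f).
Proof.
move=> rb; have b := xmap_bij rb; elim=> {f} [k|k||f _ IH|f g _ IHf _ IHg|f g _ IHf _ IHg].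
- by rewrite xren_x //; exact: nice_x.
- by rewrite xren_ainv //; exact: nice_ainv.
- by rewrite ren1 //; exact: nice_1.
- by rewrite renN //; exact: nice_N.
- by rewrite renD //; exact: nice_D.
- by rewrite renM //; exact: nice_M.
Qed.

(** For products this is the twisted Leibniz rule: f g - s_i(f) s_i(g) = (f - s_i f) g + s_i(f) (g -
    s_i g). *)
Lemma nice_dd i f : nice f ->
  exists2 q, nice q & f - xren (s_ i) f = (xv i - xv (i + 1)) * q.
Proof.
elim=> {f} [k|k||f _ [q nq e]|f g _ [q nq e] _ [q' nq' e']|f g nf [q nq e] ng [q' nq' e']].
- rewrite xren_x //; have [->|ki] := eqVneq k i.
    by exists 1; [exact: nice_1|rewrite s_l mulr1].
  have [->|ki1] := eqVneq k (i + 1).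
    by exists (- 1); [exact: nice_N nice_1|rewrite s_r mulrN1 opprB].
  by exists 0; [exact: nice_0|rewrite s_ne // subrr mulr0].
- by exists 0; [exact: nice_0|rewrite xren_ainv // subrr mulr0].
- by exists 0; [exact: nice_0|rewrite ren1 // subrr mulr0].
- by exists (- q); [exact: nice_N|rewrite renN // mulrN -e opprB opprK addrC].
- by exists (q + q'); [exact: nice_D|rewrite renD // mulrDr -e -e'; ring].
- exists (q * g + xren (s_ i) f * q').
    apply: nice_D; first exact: nice_M.
    by apply: nice_M => //; apply: nice_xren.
  rewrite renM // mulrDr mulrA -e [X in _ = _ + X]mulrCA -e'.
  by ring.
Qed.

Lemma lreg_xstep i : GRing.lreg (xv i - xv (i + 1)).
Proof. by apply: lreg_xsub; apply/eqP; lia. Qed.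

Lemma pi_tilde_eq i f h :
  (xv i - xv (i + 1)) * h =
    (1 - xv (i + 1)) * f - (1 - xv i) * xren (s_ i) f ->
  pi_tilde i f = h.
Proof.
move=> e; have E : mps_rename (swap_x i) f = xren (s_ i) f.
  by rewrite ren.unlock swap_xE.
rewrite /pi_tilde !xvarE E.
by apply: mps_quotE; [exact: lreg_xstep|rewrite mulrC].
Qed.

Lemma pi_tildeP i f : nice f -> nice (pi_tilde i f) /\
  (xv i - xv (i + 1)) * pi_tilde i f =
    (1 - xv (i + 1)) * f - (1 - xv i) * xren (s_ i) f.
Proof.
(* The numerator of pi_i(f) is g - s_i(g) for g = (1 - x_(i+1)) f. *)
move=> nf; have n1 : nice ((1 - xv (i + 1)) * f).
  by apply: nice_M => //; apply: nice_B; [exact: nice_1|exact: nice_x].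
have [q nq] := nice_dd i n1; rewrite renM // renB // ren1 // xren_x // s_r => e.
by rewrite (pi_tilde_eq (esym e)).
Qed.

Lemma nice_pi i f : nice f -> nice (pi_tilde i f).
Proof. by case/(pi_tildeP i). Qed.

(** Numerator and denominator both change sign under s_i. *)
Lemma pi_tilde_sym i f : nice f -> xren (s_ i) (pi_tilde i f) = pi_tilde i f.
Proof.
move=> nf; have [_ e] := pi_tildeP i nf; apply: (@lreg_xstep i).
have := congr1 (xren (s_ i)) e.
rewrite renB // !renM // !renB // ren1 // !xren_x // s_l s_r xren_sK => e2.
by rewrite e -[LHS]opprK -mulNr opprB e2 opprB.
Qed.

Lemma pi_tildeM i f g : nice f -> xren (s_ i) g = g ->
  pi_tilde i (g * f) = g * pi_tilde i f.
Proof.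
move=> nf gs; apply: pi_tilde_eq; rewrite renM // gs mulrCA.
by have [_ ->] := pi_tildeP i nf; ring.
Qed.

Lemma pi_tilde_omx i j : pi_tilde i (omx i j) = 1.
Proof. by apply: pi_tilde_eq; rewrite xren_omx // s_l; ring. Qed.

(** * Commutation and braid relations *)

Lemma s_far i j : i != j -> i != j + 1 -> j != i + 1 ->
  s_ i \o s_ j = s_ j \o s_ i.
Proof.
move=> ij ij1 ji1; apply/funext => k /=.
have [->|ki] := eqVneq k i; first by rewrite s_l !(@s_ne j) ?s_l //; lia.
have [->|ki1] := eqVneq k (i + 1); first by rewrite s_r !(@s_ne j) ?s_r //; lia.
rewrite (s_ne ki ki1); have [->|kj] := eqVneq k j; first by rewrite s_l !(@s_ne i) //; lia.
have [->|kj1] := eqVneq k (j + 1); first by rewrite s_r !(@s_ne i) //; lia.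
by rewrite !s_ne.
Qed.

Lemma s_braid i : s_ i \o s_ (i + 1) \o s_ i = s_ (i + 1) \o s_ i \o s_ (i + 1).
Proof.
apply/funext => k /=.
have [->|ki] := eqVneq k i.
  by rewrite s_l (@s_ne (i + 1) i) ?s_l ?s_ne //; lia.
have [->|ki1] := eqVneq k (i + 1).
  by rewrite s_r s_l (@s_ne (i + 1) i) ?(@s_ne i (i + 1 + 1)) ?s_r ?s_l //; lia.
rewrite (s_ne ki ki1); have [->|ki2] := eqVneq k (i + 1 + 1).
  by rewrite s_r s_r (@s_ne (i + 1) i) //; lia.
by rewrite !s_ne.
Qed.

(** Divided differences are used through their defining equations, cleared of denominators. In this
    form they can be permuted and then combined by pure ring identities. *)
Lemma xren_pi_eq r a b (f g h : series) : bijective r ->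
  (xv a - xv b) * h = (1 - xv b) * f - (1 - xv a) * g ->
  (xv (r a) - xv (r b)) * xren r h =
  (1 - xv (r b)) * xren r f - (1 - xv (r a)) * xren r g.
Proof.
move=> rb; have b' := xmap_bij rb; move=> /(congr1 (xren r)).
by rewrite (renB _ _ b') !(renM _ _ b') !(renB _ _ b') (ren1 _ b') !(xren_x _ rb).
Qed.

(** Here [fi], [fj], [fij] stand for the images of f under s_i, s_j and both. Once denominators are
    cleared, the two orders of the operators give the same combination of the four series. *)
Lemma comm_ring (A : comNzRingType) (xi xi1 xj xj1 p q q' t t' f fi fj fij : A) :
  (xj - xj1) * p = (1 - xj1) * t - (1 - xj) * t' ->
  (xi - xi1) * t = (1 - xi1) * f - (1 - xi) * fi ->
  (xi - xi1) * t' = (1 - xi1) * fj - (1 - xi) * fij ->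
  (xj - xj1) * q = (1 - xj1) * f - (1 - xj) * fj ->
  (xj - xj1) * q' = (1 - xj1) * fi - (1 - xj) * fij ->
  (xj - xj1) * ((xi - xi1) * p) = (xj - xj1) * ((1 - xi1) * q - (1 - xi) * q').
Proof.
move=> ep et et' eq eq'; rewrite mulrCA ep !mulrBr.
rewrite mulrCA et [in X in _ - X]mulrCA et'.
by rewrite [in X in _ = X - _]mulrCA eq [in X in _ = _ - X]mulrCA eq'; ring.
Qed.

Lemma pi_tilde_comm i j f : nice f -> i != j -> i != j + 1 -> j != i + 1 ->
  pi_tilde i (pi_tilde j f) = pi_tilde j (pi_tilde i f).
Proof.
move=> nf ij ij1 ji1; apply: pi_tilde_eq; apply: (@lreg_xstep j).
have [_ ei] := pi_tildeP i nf; have [_ ej] := pi_tildeP j nf.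
have [_ eij] := pi_tildeP j (nice_pi i nf).
have e1 : s_ i j = j by rewrite s_ne // eq_sym.
have e2 : s_ i (j + 1) = j + 1 by rewrite s_ne //; lia.
have e3 : s_ j i = i by rewrite s_ne.
have e4 : s_ j (i + 1) = i + 1 by rewrite s_ne //; lia.
have eji := xren_pi_eq (s_bij i) ej; have eij' := xren_pi_eq (s_bij j) ei.
rewrite e1 e2 in eji; rewrite e3 e4 in eij'.
have c : xren (s_ j) (xren (s_ i) f) = xren (s_ i) (xren (s_ j) f).
  rewrite (xren_comp _ (s_bij j) (s_bij i)) (xren_comp _ (s_bij i) (s_bij j)).
  by rewrite (s_far ij ij1 ji1).
rewrite c in eij'.
exact: comm_ring eij ei eij' ej eji.
Qed.

(* Both sides of the braid relation, multiplied by the three differences, are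
   the same combination of the six permuted copies of f. *)
Lemma braid_ring1 (A : comNzRingType) (x1 x2 x3 p g g' h h2 h12 f f1 f2 f21 f12 f121 : A) :
  (x1 - x2) * p = (1 - x2) * g - (1 - x1) * g' ->
  (x2 - x3) * g = (1 - x3) * h - (1 - x2) * h2 ->
  (x1 - x3) * g' = (1 - x3) * h - (1 - x1) * h12 ->
  (x1 - x2) * h = (1 - x2) * f - (1 - x1) * f1 ->
  (x1 - x3) * h2 = (1 - x3) * f2 - (1 - x1) * f21 ->
  (x2 - x3) * h12 = (1 - x3) * f12 - (1 - x2) * f121 ->
  (x1 - x2) * ((x2 - x3) * ((x1 - x3) * p)) =
  (1 - x3) ^+ 2 * ((1 - x2) * f - (1 - x1) * f1)
  - (1 - x2) ^+ 2 * ((1 - x3) * f2 - (1 - x1) * f21)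
  + (1 - x1) ^+ 2 * ((1 - x3) * f12 - (1 - x2) * f121).
Proof.
move=> ep eg eg' eh eh2 eh12.
have -> : (x1 - x2) * ((x2 - x3) * ((x1 - x3) * p)) =
  (x2 - x3) * (x1 - x3) * ((x1 - x2) * p) by ring.
rewrite ep.
have -> : (x2 - x3) * (x1 - x3) * ((1 - x2) * g - (1 - x1) * g') =
  (1 - x2) * (x1 - x3) * ((x2 - x3) * g) - (1 - x1) * (x2 - x3) * ((x1 - x3) * g') by ring.
by rewrite eg eg' -eh -eh2 -eh12; ring.
Qed.

Lemma braid_ring2 (A : comNzRingType) (x1 x2 x3 p g g' h h1 h21 f f1 f2 f12 f21 f212 : A) :
  (x2 - x3) * p = (1 - x3) * g - (1 - x2) * g' ->
  (x1 - x2) * g = (1 - x2) * h - (1 - x1) * h1 ->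
  (x1 - x3) * g' = (1 - x3) * h - (1 - x1) * h21 ->
  (x2 - x3) * h = (1 - x3) * f - (1 - x2) * f2 ->
  (x1 - x3) * h1 = (1 - x3) * f1 - (1 - x1) * f12 ->
  (x1 - x2) * h21 = (1 - x2) * f21 - (1 - x1) * f212 ->
  (x1 - x2) * ((x2 - x3) * ((x1 - x3) * p)) =
  (1 - x3) ^+ 2 * ((1 - x2) * f - (1 - x1) * f1)
  - (1 - x2) ^+ 2 * ((1 - x3) * f2 - (1 - x1) * f21)
  + (1 - x1) ^+ 2 * ((1 - x3) * f12 - (1 - x2) * f212).
Proof.
move=> ep eg eg' eh eh1 eh21.
have -> : (x1 - x2) * ((x2 - x3) * ((x1 - x3) * p)) =
  (x1 - x2) * (x1 - x3) * ((x2 - x3) * p) by ring.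
rewrite ep.
have -> : (x1 - x2) * (x1 - x3) * ((1 - x3) * g - (1 - x2) * g') =
  (1 - x3) * (x1 - x3) * ((x1 - x2) * g) - (1 - x2) * (x1 - x2) * ((x1 - x3) * g') by ring.
rewrite eg eg'.
transitivity ((1 - x2) * (1 - x3) * ((x2 - x3) * h)
   - (1 - x1) * (1 - x3) * ((x1 - x3) * h1) + (1 - x1) * (1 - x2) * ((x1 - x2) * h21)).
  by ring.
by rewrite eh eh1 eh21; ring.
Qed.

Lemma pi_tilde_braid i f : nice f ->
  pi_tilde i (pi_tilde (i + 1) (pi_tilde i f)) =
  pi_tilde (i + 1) (pi_tilde i (pi_tilde (i + 1) f)).
Proof.
move=> nf; set j := i + 1.
have e1 : s_ i i = j by rewrite s_l.
have e2 : s_ i j = i by rewrite s_r.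
have e3 : s_ i (j + 1) = j + 1 by rewrite s_ne //; lia.
have e4 : s_ j i = i by rewrite s_ne //; lia.
have e5 : s_ j j = j + 1 by rewrite s_l.
have e6 : s_ j (j + 1) = j by rewrite s_r.
have R : GRing.lreg (xv i - xv (j + 1)) by apply: lreg_xsub; lia.
apply: R; apply: (@lreg_xstep j); apply: (@lreg_xstep i); rewrite -/j.
have n1 := nice_pi i nf; have n21 := nice_pi j n1.
have m1 := nice_pi j nf; have m21 := nice_pi i m1.
have [_ p1] := pi_tildeP i n21; have [_ p2] := pi_tildeP j n1.
have [_ p3] := pi_tildeP i nf.
have p4 := xren_pi_eq (s_bij i) p2; have p5 := xren_pi_eq (s_bij j) p3.
(* Since s_i fixes pi_i(f), the same h enters the equations for g and g' in [braid_ring1]. *)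
rewrite e2 e3 (pi_tilde_sym i nf) in p4; rewrite -/j e4 e5 in p5.
have p6 := xren_pi_eq (s_bij i) p5; rewrite e1 e3 in p6.
have [_ q1] := pi_tildeP j m21; have [_ q2] := pi_tildeP i m1.
have [_ q3] := pi_tildeP j nf.
have q4 := xren_pi_eq (s_bij j) q2; have q5 := xren_pi_eq (s_bij i) q3.
rewrite -/j e4 e5 (pi_tilde_sym j nf) in q4; rewrite e2 e3 in q5.
have q6 := xren_pi_eq (s_bij j) q5; rewrite e4 e6 in q6.
have bs k := s_bij k.
have br : xren (s_ i) (xren (s_ j) (xren (s_ i) f)) =
          xren (s_ j) (xren (s_ i) (xren (s_ j) f)).
  rewrite !(xren_comp _ (bs _) (bs _)).
  rewrite !(xren_comp _ (bij_comp (bs _) (bs _)) (bs _)).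
  by rewrite s_braid.
rewrite -/j in p1 p3 q2; rewrite br in p6.
apply: etrans (braid_ring1 p1 p2 p4 p3 p5 p6) _.
exact: esym (braid_ring2 q1 q2 q4 q3 q5 q6).
Qed.

(** * Double Grothendieck polynomials are well defined *)

Lemma groth_up n w (i : nat) F : inS n w -> (0 < i < n)%N ->
  w i%:Z < w (i%:Z + 1) -> is_groth n (w \o s_ i%:Z) F ->
  is_groth n w (pi_tilde i%:Z F).
Proof.
move=> wS i_n asc; apply: groth_step => //; apply: slength_ascent => //.
exact: inS_isword wS.
Qed.

Lemma groth_inS n w F : is_groth n w F -> inS n w.
Proof.
elim=> [|{}w i {}F i_n _ _ IH]; first exact: inS_longest.
by rewrite -(comp_sK w i); apply: inS_comp => //; apply: inS_s; lia.
Qed.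

Lemma groth_nice n w F : is_groth n w F -> nice F.
Proof.
elim=> [|{}w i {}F i_n _ _ IH]; last exact: nice_pi.
by do 2![apply: nice_prod => ? _]; rewrite ominusE; exact: nice_omx.
Qed.

Lemma groth_exists n w : inS n w -> exists F, is_groth n w F.
Proof.
move: w; apply: climb_ind => [|w i wS i_n asc [F gF]].
  by eexists; exact: groth_longest.
by exists (pi_tilde i F); apply: groth_up.
Qed.

Lemma longest_dec n (i : nat) : (0 < i < n)%N -> longest n (i%:Z + 1) < longest n i%:Z.
Proof. by move=> i_n; rewrite /longest; do !case: ifP => ?; lia. Qed.

Lemma groth_inv n w F : is_groth n w F ->
  is_groth n (longest n) F /\ w = longest n \/
  exists (i : nat) F1, [/\ (0 < i < n)%N, w i%:Z < w (i%:Z + 1),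
     is_groth n (w \o s_ i%:Z) F1 & F = pi_tilde i%:Z F1].
Proof.
case=> [|{}w i {}F i_n lt gF]; [left|right].
  by split=> //; exact: groth_longest.
exists i, F; split=> //; apply: slength_ascentE lt.
by have := isword_s i (inS_isword (groth_inS gF)); rewrite comp_sK.
Qed.

(** Two different first steps at i < j meet again at w s_i s_j when j > i + 1, and at w s_i s_j s_i
    when j = i + 1. By existence some series lives at the meeting point. By induction on [mu] it
    determines F1 and F1', and the commutation or braid relation identifies the two results. *)
Lemma groth_uniq n w F F' : is_groth n w F -> is_groth n w F' -> F = F'.
Proof.
have [k] := ubnP (mu n w); elim: k w F F' => // k IH w F F' wk gF gF'.
have wS := groth_inS gF.
have no (i : nat) : (0 < i < n)%N -> w i%:Z < w (i%:Z + 1) -> w <> longest n.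
  by move=> i_n asc wl; have := longest_dec i_n; rewrite -wl; lia.
have up (i : nat) : (0 < i < n)%N -> w i%:Z < w (i%:Z + 1) ->
    (mu n (w \o s_ i) < k)%N /\ inS n (w \o s_ i).
  move=> i_n asc; split; first exact: leq_trans (mu_ascent wS i_n asc) _.
  by apply: inS_comp => //; apply: inS_s; lia.
case: (groth_inv gF) (groth_inv gF') => [[_ wl]|[i [F1 [i_n ai g1 ->]]]]; last first.
  case=> [[_ wl]|[j [F1' [j_n aj g1' ->]]]]; first by case: (no i).
  wlog: i j F1 F1' i_n j_n ai aj g1 g1' {gF gF'} / (i <= j)%N.
    move=> H; have [ij|/ltnW ji] := leqP i j; first exact: H.
    by apply/esym; apply: H.
  have [mi Si] := up _ i_n ai; have [mj Sj] := up _ j_n aj.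
  rewrite leq_eqVlt => /orP[/eqP ij|ij].
    by subst j; congr pi_tilde; apply: IH mi _ _.
  have [ij1|ij1] := eqVneq j i.+1; last first.
    have F0 : inS n (w \o s_ i \o s_ j) by apply: inS_comp => //; apply: inS_s; lia.
    have [F2 g2] := groth_exists F0.
    have cm : w \o s_ i \o s_ j = w \o s_ j \o s_ i.
      by rewrite -compA s_far //; lia.
    rewrite (IH _ _ _ mi g1 (groth_up Si j_n _ g2)); last first.
      by rewrite /= !s_ne //; lia.
    rewrite cm in g2.
    rewrite (IH _ _ _ mj g1' (groth_up Sj i_n _ g2)); last first.
      by rewrite /= !s_ne //; lia.
    by apply: pi_tilde_comm; [exact: groth_nice g2|lia..].
  subst j; have e : i.+1%:Z = i%:Z + 1 by lia.
  rewrite e in aj Sj g1' mj *.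
  have n1 : s_ i (i%:Z + 1 + 1) = i%:Z + 1 + 1 by rewrite s_ne //; lia.
  have n2 : s_ (i%:Z + 1) i = i by rewrite s_ne //; lia.
  have Sij : inS n (w \o s_ i \o s_ (i%:Z + 1)).
    by apply: inS_comp => //; apply: inS_s; lia.
  have Sji : inS n (w \o s_ (i%:Z + 1) \o s_ i).
    by apply: inS_comp => //; apply: inS_s; lia.
  have F0 : inS n (w \o s_ i \o s_ (i%:Z + 1) \o s_ i).
    by apply: inS_comp => //; apply: inS_s; lia.
  have [F3 g3] := groth_exists F0.
  have br : w \o s_ i \o s_ (i%:Z + 1) \o s_ i = w \o s_ (i%:Z + 1) \o s_ i \o s_ (i%:Z + 1).
    by have := congr1 (comp w) (s_braid i).
  have g2 : is_groth n (w \o s_ i \o s_ (i%:Z + 1)) (pi_tilde i F3).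
    by apply: groth_up => //=; rewrite n2 !s_l n1.
  have g2' : is_groth n (w \o s_ (i%:Z + 1) \o s_ i) (pi_tilde (i%:Z + 1) F3).
    rewrite br -e in g3 Sji *; apply: groth_up => //=.
    by rewrite e (s_r i) n2 n1 s_r; lia.
  rewrite (IH _ _ _ mi g1 (_ : is_groth n _ (pi_tilde (i%:Z + 1) (pi_tilde i F3)))); last first.
    rewrite -e in g2 *; apply: groth_up => //=.
    by rewrite e s_r n1; lia.
  rewrite (IH _ _ _ mj g1' (_ : is_groth n _ (pi_tilde i (pi_tilde (i%:Z + 1) F3)))); last first.
    by apply: groth_up => //=; rewrite n2 s_l; lia.
  by apply: pi_tilde_braid; exact: groth_nice g3.
move=> h; move: gF gF'; rewrite wl => gF gF'.
(* At w_0 only the base case can apply, since a step requires an ascent. *)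
have inv G : is_groth n (longest n) G -> G = \prod_(1 <= i < n)
    \prod_(1 <= j < n | (i + j <= n)%N) ominus (xvar i%:Z) (avar j%:Z).
  move E: (longest n) => w0 g0; case: g0 E => [//|w1 i G1 i_n lt g1 E].
  have S1 := groth_inS g1; have := @slength_ascentE w1 i.
  rewrite -{1}E => /(_ (inS_isword (inS_longest n)) lt).
  by rewrite -E; have := longest_dec i_n; lia.
by rewrite (inv _ gF) (inv _ gF').
Qed.

(** * Dominant permutations *)

Definition countlt n (w : int -> int) (k : nat) (v : int) : nat :=
  \sum_(k <= j < n.+1) (w j%:Z < v)%R.

(** The Lehmer code of w. *)
Definition code n w (i : nat) : nat := countlt n w i.+1 (w i%:Z).

Lemma countlt_rec n w k v : (k <= n)%N ->
  countlt n w k v = ((w k%:Z < v)%R + countlt n w k.+1 v)%N.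
Proof. by move=> kn; rewrite /countlt big_ltn. Qed.

Lemma countlt_mono n w k v v' : v <= v' -> (countlt n w k v <= countlt n w k v')%N.
Proof.
move=> vv; apply: leq_sum => j _; case: ltP => //= jv.
by rewrite (lt_le_trans jv vv).
Qed.

Lemma countlt_eq n w w' k v : (forall j : nat, (k <= j)%N -> w j%:Z = w' j%:Z) ->
  countlt n w k v = countlt n w' k v.
Proof. by move=> ww; apply: eq_big_nat => j /andP[kj _]; rewrite ww. Qed.

Section Code.
Variables (n : nat) (w : int -> int) (i : nat).
Hypothesis i_n : (0 < i < n)%N.
Let iS : i.+1%:Z = i%:Z + 1. Proof. by lia. Qed.
Let far (k : nat) : (k != i)%N -> (k != i.+1)%N -> (w \o s_ i%:Z) k%:Z = w k%:Z.
Proof. by move=> ki ki1; rewrite /= s_ne //; lia. Qed.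

Lemma countlt_swap_hi k v : (i.+1 < k)%N ->
  countlt n (w \o s_ i%:Z) k v = countlt n w k v.
Proof. by move=> ki; apply: countlt_eq => j kj; apply: far; lia. Qed.

Lemma countlt_swap_lo k v : (k <= i)%N ->
  countlt n (w \o s_ i%:Z) k v = countlt n w k v.
Proof.
move=> ki; rewrite /countlt !(@big_cat_nat _ _ _ i k n.+1) //; try lia.
congr addn.
  by apply: eq_big_nat => j /andP[_ ji]; rewrite far //; lia.
rewrite -!/(countlt n _ i v) !(@countlt_rec _ _ i) ?(@countlt_rec _ _ i.+1); try lia.
rewrite countlt_swap_hi //= iS s_l s_r; lia.
Qed.

Lemma code_swap_lt k : (k < i)%N -> code n (w \o s_ i%:Z) k = code n w k.
Proof. by move=> ki; rewrite /code countlt_swap_lo // far //; lia. Qed.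

Lemma code_swap_gt k : (i.+1 < k)%N -> code n (w \o s_ i%:Z) k = code n w k.
Proof. by move=> ki; rewrite /code countlt_swap_hi ?far //; lia. Qed.

Hypothesis asc : w i%:Z < w (i%:Z + 1).

Lemma code_swap_i : code n (w \o s_ i%:Z) i = (code n w i.+1).+1.
Proof.
rewrite /code countlt_rec; last by lia.
rewrite countlt_swap_hi //= iS s_l s_r asc; lia.
Qed.

Lemma code_swap_i1 : code n (w \o s_ i%:Z) i.+1 = code n w i.
Proof.
rewrite /code [RHS]countlt_rec; last by lia.
rewrite countlt_swap_hi //= iS s_r ltNge (ltW asc); lia.
Qed.

Lemma code_ascent_le : (code n w i <= code n w i.+1)%N.
Proof.
rewrite /code countlt_rec; last by lia.
rewrite iS ltNge (ltW asc) /= add0n; apply: countlt_mono; exact: ltW.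
Qed.
End Code.

Lemma code_descent_lt n w (i : nat) : (0 < i < n)%N -> w (i%:Z + 1) < w i%:Z ->
  (code n w i.+1 < code n w i)%N.
Proof.
move=> i_n desc; have iS : i.+1%:Z = i%:Z + 1 by lia.
rewrite /code [X in (_ < X)%N]countlt_rec; last by lia.
by rewrite iS desc /= add1n ltnS; apply: countlt_mono; exact: ltW.
Qed.

Lemma code_longest n (i : nat) : (0 < i <= n)%N -> code n (longest n) i = (n - i)%N.
Proof.
move=> i_n; rewrite /code /countlt.
under eq_big_nat => j jn.
  have -> : longest n j%:Z < longest n i%:Z.
    by rewrite /longest; do !case: ifP => ?; lia.
  over.
by rewrite sum_nat_const_nat muln1; lia.
Qed.

Definition dominant n w := forall i : nat, (0 < i < n)%N -> (code n w i.+1 <= code n w i)%N.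

Definition boxes (i c : nat) : series := \prod_(1 <= j < c.+1) omx i%:Z j%:Z.

Definition domprod n w : series := \prod_(1 <= i < n.+1) boxes i (code n w i).

Lemma boxesS i c : boxes i c.+1 = boxes i c * omx i%:Z c.+1%:Z.
Proof. by rewrite /boxes big_nat_recr. Qed.

Lemma xren_boxes r i j c : bijective r -> r i%:Z = j%:Z -> xren r (boxes i c) = boxes j c.
Proof.
move=> rb rij; rewrite /boxes (ren_prod _ _ _ (xmap_bij rb)).
by apply: eq_bigr => k _; rewrite (xren_omx _ _ rb) rij.
Qed.

Lemma big_nat_D2 (A : comNzRingType) n (i : nat) (F : nat -> A) : (0 < i < n)%N ->
  \prod_(1 <= k < n.+1) F k =
  F i * (F i.+1 * \prod_(1 <= k < n.+1 | (k != i) && (k != i.+1)) F k).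
Proof.
move=> i_n.
rewrite (bigD1_seq i) ?iota_uniq ?mem_index_iota //=; last by lia.
congr (_ * _); rewrite -big_filter.
rewrite (bigD1_seq i.+1) ?filter_uniq ?iota_uniq ?mem_filter ?mem_index_iota //=; last by lia.
by rewrite big_filter_cond.
Qed.

Lemma domprod_longest n : domprod n (longest n) =
  \prod_(1 <= i < n) \prod_(1 <= j < n | (i + j <= n)%N)
    ominus (xvar i%:Z) (avar j%:Z).
Proof.
rewrite /domprod; case: n => [|n]; first by rewrite !big_geq.
rewrite big_nat_recr //.
have -> : code n.+1 (longest n.+1) n.+1 = 0%N by rewrite code_longest ?subnn ?leqnn.
have -> : boxes n.+1 0 = 1 by rewrite /boxes big_geq.
rewrite /= mulr1 /boxes.
apply: eq_big_nat => i i_n; rewrite code_longest; last by lia.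
apply/esym; under eq_bigr do rewrite ominusE.
rewrite [RHS](@big_nat_widen _ _ _ 1 (n.+1 - i).+1 n.+1); last by lia.
by apply: eq_bigl => j; lia.
Qed.

(** The climb to w_0 stays among dominant permutations. Let i be least with equal codes c at i and i
    + 1. This is an ascent, and exchanging the values turns the codes into c + 1 and c, which is
    still dominant because row i - 1 is strictly longer than c. The product gains the factor x_i
    ominus a_(c+1); the rest is symmetric in x_i and x_(i+1), and pi_i sends the extra factor to 1.
    If no such i exists, the codes decrease strictly and w = w_0. *)
Lemma groth_dominant n w : inS n w -> dominant n w -> is_groth n w (domprod n w).
Proof.
have [k] := ubnP (mu n w); elim: k w => // k IH w wk wS wd.
pose P i := [&& (0 < i)%N, (i < n)%N & code n w i == code n w i.+1].
case: (pselect (exists i, P i)) => [ex|no]; last first.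
  have dec i : (0 < i < n)%N -> w (i%:Z + 1) < w i%:Z.
    move=> i_n; have := wd i i_n; rewrite leq_eqVlt => /orP[/eqP e|lt].
      by case: no; exists i; rewrite /P andbA i_n e eqxx.
    have [//|ge] := ltP (w (i%:Z + 1)) (w i).
    have ne : w i != w (i%:Z + 1) by apply/eqP => /wS.1; lia.
    have := @code_ascent_le n w i i_n; rewrite lt_neqAle ne ge leqNgt lt.
    by move/(_ isT).
  by rewrite (decreasing_longest wS dec) domprod_longest; exact: groth_longest.
case: (ex_minnP ex) => i /and3P[i0 lt_in /eqP ci] imin.
have i_n : (0 < i < n)%N by rewrite i0.
have asc : w i < w (i%:Z + 1).
  have [//|ge] := ltP (w i) (w (i%:Z + 1)).
  have ne : w (i%:Z + 1) != w i by apply/eqP => /wS.1; lia.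
  by have := @code_descent_lt n w i i_n; rewrite lt_neqAle ne ge ci ltnn => /(_ isT).
have g : is_groth n (w \o s_ i) (domprod n (w \o s_ i)).
  apply: IH; first exact: leq_trans (mu_ascent wS i_n asc) _.
    by apply: inS_comp => //; apply: inS_s; lia.
  move=> j j_n; have wdj := wd j j_n.
  have [->|ji] := eqVneq j i; first by rewrite code_swap_i1 // code_swap_i // ci.
  have [e|ji1] := eqVneq j i.+1.
    by rewrite e in j_n *; rewrite code_swap_gt // code_swap_i1 // ci; apply: wd; lia.
  have [e|ji2] := eqVneq j.+1 i.
    rewrite e code_swap_i // -ci code_swap_lt //; last by lia.
    rewrite e in wdj; rewrite ltn_neqAle wdj andbT; apply/eqP => e2.
    by have := imin j; rewrite /P e e2 eqxx; lia.
  have [lt|gt] := ltnP j i.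
    have lt' : (j.+1 < i)%N by lia.
    by rewrite (code_swap_lt w i_n lt) (code_swap_lt w i_n lt').
  have gt1 : (i.+1 < j)%N by lia.
  have gt2 : (i.+1 < j.+1)%N by lia.
  by rewrite (code_swap_gt w i_n gt1) (code_swap_gt w i_n gt2).
have := groth_up wS i_n asc g; congr is_groth.
set c := code n w i.
have E : domprod n (w \o s_ i) = domprod n w * omx i%:Z c.+1%:Z.
  rewrite /domprod !(big_nat_D2 _ i_n) code_swap_i // code_swap_i1 // -ci -/c boxesS.
  have -> : \prod_(1 <= k < n.+1 | (k != i) && (k != i.+1)) boxes k (code n (w \o s_ i) k)
     = \prod_(1 <= k < n.+1 | (k != i) && (k != i.+1)) boxes k (code n w k).
    apply: eq_bigr => j /andP[ji ji1]; congr boxes.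
    by have [lt|gt] := ltnP j i; [rewrite code_swap_lt|rewrite code_swap_gt //; lia].
  by ring.
rewrite E pi_tildeM; first by rewrite pi_tilde_omx mulr1.
  exact: nice_omx.
have b := xmap_bij (s_bij i).
rewrite /domprod (big_nat_D2 _ i_n) -ci -/c !(renM _ _ b).
have iS : i.+1%:Z = i%:Z + 1 by lia.
have e1 : s_ i i = i.+1%:Z by rewrite s_l iS.
have e2 : s_ i i.+1%:Z = i by rewrite iS s_r.
rewrite (xren_boxes _ (s_bij i) e1) (xren_boxes _ (s_bij i) e2).
rewrite (ren_prod _ _ _ b) mulrCA; do 2 congr (_ * _).
by apply: eq_bigr => j /andP[ji ji1]; apply: (xren_boxes _ (s_bij i)); rewrite s_ne //; lia.
Qed.

(** * Antisymmetrization and the bialternant formula *)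

Section Antisymmetrizer.
Variable m : nat.

(** Ordinals start at 0 and the variables at x_1, hence the shift by one. *)
Definition pext (s : 'S_m) (k : int) : int :=
  if k is Posz k'.+1 then
    if insub k' is Some i then (s i).+1%:Z else k
  else k.

Lemma pext_ord s (i : 'I_m) : pext s i.+1%:Z = (s i).+1%:Z.
Proof. by rewrite /pext /= valK. Qed.

Lemma pext_out s k : ~~ (1 <= k <= m%:Z) -> pext s k = k.
Proof.
case: k => [[|k]|k] //= km; rewrite /pext; case: insubP => // i ltm _; move: km.
by have := ltm; lia.
Qed.

Variant pext_spec (k : int) : Prop :=
| PextIn (i : 'I_m) of k = i.+1%:Z
| PextOut of ~~ (1 <= k <= m%:Z).

Lemma pextP k : pext_spec k.
Proof.
case: (boolP (1 <= k <= m%:Z)) => [|h]; last exact: PextOut.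
case: k => [[|k]|k] // h; have km : (k < m)%N by lia.
exact: (@PextIn _ (Ordinal km)).
Qed.

Lemma pextM s t : pext (s * t)%g = pext t \o pext s.
Proof.
apply/funext => k /=; case: (pextP k) => [i ->|h]; last by rewrite !pext_out.
by rewrite !pext_ord permM.
Qed.

Lemma pext1 : pext 1%g = id.
Proof.
apply/funext => k; case: (pextP k) => [i ->|h]; last by rewrite !pext_out.
by rewrite pext_ord perm1.
Qed.

Lemma pext_bij s : bijective (pext s).
Proof.
exists (pext s^-1%g) => k.
  by have := congr1 (@^~ k) (pextM s s^-1%g); rewrite mulgV pext1.
by have := congr1 (@^~ k) (pextM s^-1%g s); rewrite mulVg pext1.
Qed.

Lemma pext_inS s : inS m (pext s).
Proof. by split=> [|j /pext_out//]; exact: bij_inj (pext_bij s). Qed.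

Lemma pext_tperm (i j : 'I_m) : j = i.+1 :> nat -> pext (tperm i j) = s_ i.+1%:Z.
Proof.
move=> ij; apply/funext => k; have e : j.+1%:Z = i.+1%:Z + 1 by lia.
case: (pextP k) => [l ->|h]; last first.
  by rewrite pext_out // s_ne //; apply/eqP => kE; move: h; have := ltn_ord j; lia.
rewrite pext_ord; case: tpermP => [->|->|/eqP li /eqP lj].
- by rewrite s_l e.
- by rewrite e s_r.
- rewrite s_ne // -?e.
  by apply: contra lj => /eqP h; apply/eqP/ord_inj; lia.
Qed.

Definition asym (f : series) : series :=
  \sum_(s : 'S_m) (-1) ^+ s * xren (pext s) f.

Let xb s := xmap_bij (pext_bij s).

Lemma asymD f g : asym (f + g) = asym f + asym g.
Proof.
by rewrite -big_split; apply: eq_bigr => s _; rewrite (renD _ _ (xb s)) mulrDr.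
Qed.

Lemma asymN f : asym (- f) = - asym f.
Proof.
by rewrite -sumrN; apply: eq_bigr => s _; rewrite (renN _ (xb s)) mulrN.
Qed.

Lemma asym_s (i : nat) f : (0 < i < m)%N -> asym (xren (s_ i%:Z) f) = - asym f.
Proof.
move=> i_m; have i1 : (i.-1 < m)%N by lia.
have i2 : (i < m)%N by lia.
pose a := Ordinal i1; pose b := Ordinal i2.
have ab : b = a.+1 :> nat by rewrite /=; lia.
have E : s_ i = pext (tperm a b) by rewrite (pext_tperm ab); congr s_; rewrite /=; lia.
rewrite /asym [in RHS](reindex_inj (mulgI (tperm a b))) -sumrN /=.
apply: eq_bigr => s _.
have ne : a != b by apply/eqP => /(congr1 val) /=; lia.
rewrite odd_permM odd_tperm ne addTb pextM E (xren_comp _ (pext_bij _) (pext_bij _)).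
by rewrite signrN mulNr opprK.
Qed.

Lemma series_double_inj (f g : series) : f + f = g + g -> f = g.
Proof.
move=> e; apply: mpseriesP => k; have := congr1 (fun h : series => h k) e.
by rewrite !mpcoefD; lia.
Qed.

(** The diagonal term of the Vandermonde determinant in the y_j = 1 - x_j, so that antisymmetrizing
    it gives that determinant. *)
Definition rho : series := \prod_(i < m) (1 - xv i.+1%:Z) ^+ i.

Lemma rho_s (i : nat) : (0 < i < m)%N ->
  (1 - xv (i%:Z + 1)) * xren (s_ i%:Z) rho = (1 - xv i%:Z) * rho.
Proof.
move=> i_m; have b := xmap_bij (s_bij i).
rewrite /rho (ren_prod _ _ _ b).
have E : forall j : 'I_m, xren (s_ i) ((1 - xv j.+1%:Z) ^+ j) = (1 - xv (s_ i j.+1%:Z)) ^+ j.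
  by move=> j; rewrite (renX _ _ b) (renB _ _ b) (ren1 _ b) (xren_x _ (s_bij i)).
under eq_bigr do rewrite E.
have i1 : (i.-1 < m)%N by lia.
have i2 : (i < m)%N by lia.
rewrite (bigD1 (Ordinal i1)) //= (bigD1 (Ordinal i2)) /=; last by apply/eqP => /(congr1 val) /=; lia.
rewrite [in RHS](bigD1 (Ordinal i1)) //= [in RHS](bigD1 (Ordinal i2)) /=; last by apply/eqP => /(congr1 val) /=; lia.
have -> : i.-1.+1 = i by lia.
have iS : i.+1%:Z = i%:Z + 1 by lia.
rewrite iS s_l s_r.
rewrite [in LHS](eq_bigr (fun j : 'I_m => (1 - xv j.+1%:Z) ^+ j)); last first.
  move=> j /andP[j1 j2]; rewrite s_ne //.
    by apply: contra j1 => /eqP h; apply/eqP/val_inj; rewrite /=; lia.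
  by apply: contra j2 => /eqP h; apply/eqP/val_inj; rewrite /=; lia.
set P := \prod_(_ | _) _.
have -> : i = i.-1.+1 by lia.
by rewrite !exprS /=; ring.
Qed.

(* With y_i = 1 - x_i, the relation y_(i+1) s_i(rho) = y_i rho makes rho f and
   rho pi_i(f) have the same image under 1 - s_i, and asym kills twice the
   difference. *)
Lemma asym_pi (i : nat) f : (0 < i < m)%N -> nice f ->
  asym (rho * pi_tilde i%:Z f) = asym (rho * f).
Proof.
move=> i_m nf; have b := xmap_bij (s_bij i).
have [_ e] := pi_tildeP i nf.
have key : rho * pi_tilde i f - xren (s_ i) (rho * pi_tilde i f) =
           rho * f - xren (s_ i) (rho * f).
  apply: (@lreg_1sub_var _ _ (inl (i%:Z + 1))).
  rewrite !(renM _ _ b) (pi_tilde_sym i nf).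
  have := rho_s i_m; move: e.
  move: (pi_tilde i f) (xren (s_ i) f) (xren (s_ i) rho) => g sf sr e er.
  have -> : (1 - xv (i%:Z + 1)) * (rho * g - sr * g) =
    (1 - xv (i%:Z + 1)) * rho * g - ((1 - xv (i%:Z + 1)) * sr) * g by ring.
  have -> : (1 - xv (i%:Z + 1)) * (rho * f - sr * sf) =
    (1 - xv (i%:Z + 1)) * rho * f - ((1 - xv (i%:Z + 1)) * sr) * sf by ring.
  rewrite er.
  have -> : (1 - xv (i%:Z + 1)) * rho * g - (1 - xv i%:Z) * rho * g =
     rho * ((xv i%:Z - xv (i%:Z + 1)) * g) by ring.
  by rewrite e; ring.
have := congr1 asym key.
rewrite !asymD !asymN !(asym_s _ i_m) !opprK.
exact: series_double_inj.
Qed.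

Lemma asym_sym F : (forall i : nat, (0 < i < m)%N -> xren (s_ i%:Z) F = F) ->
  asym (rho * F) = F * asym rho.
Proof.
move=> sF; have fixF s : xren (pext s) F = F.
  have [t tm <-] := inS_word (pext_inS s).
  elim: t tm => [|a t IH] /=; first by rewrite xren_id.
  case/andP => am /IH tF; have := xren_comp F (s_bij a) (wordprod_bij t).
  rewrite tF => <-; case: a am => // a am; apply: sF; lia.
rewrite /asym mulr_sumr; apply: eq_bigr => s _.
by rewrite (renM _ _ (xb s)) fixF mulrA mulrC.
Qed.

(** This is the Leibniz formula: the hypothesis says that renaming moves only the column variable of
    an entry. *)
Lemma asym_det (phi : 'I_m -> int -> series) :
  (forall r i k, bijective r -> xren r (phi i k) = phi i (r k)) ->
  asym (\prod_i phi i i.+1%:Z) = \det (\matrix_(i, j) phi i j.+1%:Z).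
Proof.
move=> H; rewrite /asym /determinant; apply: eq_bigr => s _; congr (_ * _).
rewrite (ren_prod _ _ _ (xb s)); apply: eq_bigr => i _.
by rewrite (H _ _ _ (pext_bij s)) pext_ord mxE.
Qed.

Definition xdelta : series :=
  \prod_(i < m) \prod_(j < m | (i < j)%N) (xv i.+1%:Z - xv j.+1%:Z).

Lemma asym_rho : asym rho = xdelta.
Proof.
rewrite /rho (@asym_det (fun i k => (1 - xv k) ^+ i)); last first.
  move=> r i k rb; have b := xmap_bij rb.
  by rewrite (renX _ _ b) (renB _ _ b) (ren1 _ b) (xren_x _ rb).
have -> : \matrix_(i, j) (1 - xv j.+1%:Z) ^+ i = Vandermonde m (\row_(j < m) (1 - xv j.+1%:Z)).
  by apply/matrixP => i j; rewrite !mxE.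
rewrite det_Vandermonde; apply: eq_bigr => i _; apply: eq_bigr => j _.
by rewrite !mxE; ring.
Qed.

Lemma lreg_xdelta : GRing.lreg xdelta.
Proof.
apply: lreg_prod => i _; apply: lreg_prod => j ij; apply: lreg_xsub.
by apply/eqP; lia.
Qed.
End Antisymmetrizer.

(** * Grassmannian permutations and their determinant *)

(** The count over all positions is unchanged by the exchanges of the climb, so w may be replaced by
    the identity. *)
Lemma countlt_perm n w c : inS n w -> (c <= n)%N -> countlt n w 1 c.+1%:Z = c.
Proof.
move=> wS cn; have inv w' : inS n w' -> countlt n w' 1 c.+1%:Z = countlt n (longest n) 1 c.+1%:Z.
  move: w'; apply: climb_ind => // w' i w'S i_n asc <-.
  by rewrite countlt_swap_lo //; lia.
rewrite (inv _ wS) -(inv _ (@inS_id n)) /countlt (@big_cat_nat _ _ _ c.+1) //=.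
rewrite (@eq_big_nat _ _ _ 1 c.+1 _ (fun=> 1%N)); last by move=> j ?; case: ltP => //=; lia.
rewrite (@eq_big_nat _ _ _ c.+1 n.+1 _ (fun=> 0%N)); last by move=> j ?; case: ltP => //=; lia.
by rewrite !sum_nat_const_nat; lia.
Qed.

Lemma groth_grassmannian n m v F (c : nat -> nat) :
  inS n v -> (m <= n)%N ->
  (forall j k : int, 1 <= j -> j < k -> k <= m%:Z -> v j < v k) ->
  (forall j k : int, m%:Z < j -> j < k -> v j < v k) ->
  (forall i, (i < m)%N -> v (m - i)%N%:Z = (c i).+1%:Z) ->
  is_groth n v F ->
  F * xdelta m =
  \det (\matrix_(i < m, j < m) ((1 - xv j.+1%:Z) ^+ i * boxes j.+1 (c i))).
Proof.
move=> vS mn inc1 inc2 vc gF.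
(* Reversing the increasing block v(1), ..., v(m) gives a dominant permutation whose code is c_0,
   ..., c_(m-1) followed by zeros. *)
pose u := v \o longest m.
have uS : inS n u by apply: inS_comp => //; apply: inS_sub mn (inS_longest m).
have uE (i : nat) : (i < m)%N -> u i.+1%:Z = (c i).+1%:Z.
  move=> im; rewrite -vc //= /u /longest /=; case: ifP => h; last by lia.
  by congr v; lia.
have u_dec (i j : nat) : (i < j)%N -> (j < m)%N -> u j.+1%:Z < u i.+1%:Z.
  by move=> ij jm; rewrite !uE ?(ltn_trans ij jm) // -!vc ?(ltn_trans ij jm) //; apply: inc1; lia.
(* The entries of u to the left are larger, so all c_i values below u(i+1) = c_i + 1 stand to its
   right. *)
have codeE (i : nat) : (i < m)%N -> code n u i.+1 = c i.
  move=> im; have cn : (c i <= n)%N.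
    by have := @inS_range n u i.+1%:Z uS; rewrite uE //; lia.
  rewrite -[RHS](countlt_perm uS cn) -uE // /code.
  rewrite [RHS]/countlt (@big_cat_nat _ _ _ i.+2) //=; last by lia.
  rewrite big_nat big1 //= => j /andP[j1 ji]; case: ltP => //= lt.
  have [e|ne] := eqVneq j i.+1; first by move: lt; rewrite e; lia.
  have ji' : (j.-1 < i)%N by lia.
  have := u_dec _ _ ji' im; have -> : j.-1.+1 = j by lia.
  by move=> lt'; have := lt_trans lt lt'; rewrite ltxx.
have code0 (i : nat) : (m < i)%N -> code n u i = 0%N.
  move=> mi; rewrite /code /countlt big_nat big1 // => j /andP[ij jn].
  case: ltP => //= lt; have : u i%:Z < u j%:Z; last by lia.
  by rewrite /u /= /longest; do !case: ifP => ?; try lia; apply: inc2; lia.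
have udom : dominant n u.
  move=> i i_n; have [im|mi] := ltnP i m; last by rewrite code0.
  case: i i_n im => // i i_n im; have im' : (i < m)%N by lia.
  rewrite !codeE //; have := u_dec i i.+1 (ltnSn i) im.
  by rewrite !uE //; lia.
have gu := groth_dominant uS udom.
(* As v increases on 1, ..., m, an ascent of tau is an ascent of v tau. So the way from u down to v
   uses only operators pi_i with i < m, which [asym_pi] absorbs. *)
have chain tau : inS m tau -> forall G, is_groth n (v \o tau) G ->
    asym m (rho m * G) = asym m (rho m * domprod n u).
  move: tau; apply: climb_ind => [G gG|tau i tS i_m asc IH G gG].
    by rewrite (groth_uniq gG gu).
  have S1 : inS n (v \o tau) by apply: inS_comp => //; apply: inS_sub mn tS.
  have asc1 : (v \o tau) i%:Z < (v \o tau) (i%:Z + 1).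
    by apply: inc1 => //; [have := @inS_range m tau i tS|have := @inS_range m tau (i%:Z + 1) tS]; lia.
  have i_n : (0 < i < n)%N by lia.
  have [G1 g1] : exists G, is_groth n (v \o tau \o s_ i) G.
    by apply: groth_exists; apply: inS_comp => //; apply: inS_s; lia.
  rewrite (groth_uniq gG (groth_up S1 i_n asc1 g1)) asym_pi //; first exact: IH.
  exact: groth_nice g1.
have := chain id (@inS_id m) F gF.
rewrite asym_sym; last first.
  move=> i i_m; have i_n : (0 < i < n)%N by lia.
  have asc : v i < v (i%:Z + 1) by apply: inc1; lia.
  have [G1 g1] : exists G, is_groth n (v \o s_ i) G.
    by apply: groth_exists; apply: inS_comp => //; apply: inS_s; lia.
  rewrite (groth_uniq gF (groth_up vS i_n asc g1)); apply: pi_tilde_sym.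
  exact: groth_nice g1.
rewrite asym_rho => ->.
rewrite -(@asym_det m (fun i k => (1 - xv k) ^+ i * \prod_(1 <= j < (c i).+1) omx k j%:Z)); last first.
  move=> r i k rb; have b := xmap_bij rb.
  rewrite (renM _ _ b) (renX _ _ b) (renB _ _ b) (ren1 _ b) (xren_x _ rb).
  congr (_ * _); rewrite (ren_prod _ _ _ b).
  by apply: eq_bigr => j _; rewrite (xren_omx _ _ rb).
congr asym; rewrite big_split /=; congr (_ * _).
rewrite /domprod (@big_cat_nat _ _ _ m.+1) //= [X in _ * X]big_nat [X in _ * X]big1; last first.
  by move=> i /andP[mi _]; rewrite code0 // /boxes big_geq.
rewrite mulr1 big_add1 /= big_mkord; apply: eq_bigr => i _.
by rewrite codeE.
Qed.

(** * The branching rule for bialternants *)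

(** The next row of a pattern is summed over as a function between finite types, with parts bounded
    by B; extension by zero turns it back into a partition. *)
Definition ffext (B M : nat) (nu : {ffun 'I_M -> 'I_B.+1}) (i : nat) : nat :=
  if insub i is Some j then nu j else 0%N.

Lemma ffextE B M (nu : {ffun 'I_M -> 'I_B.+1}) (i : 'I_M) : ffext nu i = nu i.
Proof. by rewrite /ffext valK. Qed.

Lemma ffext_out B M (nu : {ffun 'I_M -> 'I_B.+1}) i : (M <= i)%N -> ffext nu i = 0%N.
Proof. by move=> Mi; rewrite /ffext insubF // ltnNge Mi. Qed.

(* The admissible entries of the next row of a Gelfand-Tsetlin pattern. *)
Definition strip (B M : nat) (lam : nat -> nat) (i : 'I_M) : pred 'I_B.+1 :=
  [pred s : 'I_B.+1 | (lam i.+1 <= s <= lam i)%N].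

Section Branching.
Variables (A : comNzRingType) (Y b : nat -> A) (B : nat).
Implicit Types (lam nu : nat -> nat) (x y : A).

Definition fac (c : nat) y : A := 1 - y * b c.
(** For y = 1 - x and b_j = 1 / (1 - a_j) this is the factorial power [x | a]^c, the product of the
    x ominus a_j. *)
Definition facs y (c : nat) : A := \prod_(1 <= j < c.+1) fac j y.

(** The weight, up to sign, of a row between its entries i + 1 and i, with l = lam_i, l' = lam_(i+1)
    and s = nu_i. The product is over the empty tiles; the last factor is the NW elbow, absent when
    the pipe goes straight up, that is when s = l'. The offset M - i comes from numbering the
    columns from the western end of the finite model. *)
Definition strip_wt1 (M i l l' s : nat) : A :=
  (\prod_(s.+1 <= j < l.+1) fac (j + M - i) (Y M.+1)) *
  (if (l' < s)%N then Y M.+1 * b (s + M - i) else 1).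

Definition strip_wt (M : nat) lam nu : A :=
  \prod_(i < M.+1) strip_wt1 M i (lam i) (lam i.+1) (nu i).

Fixpoint gt_sum (M : nat) lam : A :=
  if M is M'.+1 then
    \sum_(nu : {ffun 'I_M' -> 'I_B.+1} | nu \in family (@strip B _ lam))
      strip_wt M' lam (ffext nu) * gt_sum M' (ffext nu)
  else 1.

Definition alt_mx (M : nat) lam : 'M[A]_M :=
  \matrix_(i, j) (Y j.+1 ^+ i * facs (Y j.+1) (lam i + (M - i.+1))).

Definition ydelta (M : nat) : A :=
  \prod_(i < M) \prod_(j < M | (i < j)%N) (Y j.+1 - Y i.+1).

Lemma ydeltaS M : ydelta M.+1 = ydelta M * \prod_(j < M) (Y M.+1 - Y j.+1).
Proof.
rewrite /ydelta big_ord_recr /= [X in _ * X]big1 ?mulr1; last first.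
  by move=> j; have := ltn_ord j; lia.
rewrite -big_split /=; apply: eq_bigr => i _.
rewrite big_mkcond big_ord_recr /= ltn_ord; congr (_ * _).
by rewrite [RHS]big_mkcond.
Qed.

Lemma facs_cat y l k : (l <= k)%N ->
  facs y k = facs y l * \prod_(l.+1 <= c < k.+1) fac c y.
Proof. by move=> lk; rewrite /facs (@big_cat_nat _ _ _ l.+1). Qed.

(** Replacing x by y in the last factor costs (y - x) b_c, and induction on d collects these terms.
    The e-th summand will be the row with nu_i = lam_(i+1) + e, so that 0 < e marks the NW elbow. *)
Lemma fac_telescope x y l d :
  y * \prod_(l.+1 <= c < (l.+1 + d).+1) fac c x -
  x * \prod_(l.+1 <= c < (l.+1 + d).+1) fac c y =
  (y - x) * \sum_(0 <= e < d.+1)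
    (\prod_(l.+1 <= c < l.+1 + e) fac c x) *
    ((\prod_((l.+1 + e).+1 <= c < (l.+1 + d).+1) fac c y) *
     (if (0 < e)%N then y * b (l.+1 + e) else 1)).
Proof.
elim: d => [|d IH].
  rewrite addn0 !big_nat1 addn0 !big_geq //= /fac; ring.
rewrite addnS !(@big_nat_recr _ _ _ (l.+1 + d).+1 l.+1); try lia.
rewrite /=.
rewrite [\sum_(0 <= e < d.+2) _]big_nat_recr //=.
rewrite (@eq_big_nat _ _ _ 0 d.+1 _ (fun e => (\prod_(l.+1 <= c < l.+1 + e) fac c x) *
    ((\prod_((l.+1 + e).+1 <= c < (l.+1 + d).+1) fac c y) *
     (if (0 < e)%N then y * b (l.+1 + e) else 1)) * fac (l.+1 + d).+1 y)); last first.
  move=> e e_d; rewrite (@big_nat_recr _ _ _ (l.+1 + d).+1 (l.+1 + e).+1) /=; last by lia.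
  ring.
rewrite -big_distrl /= addnS [in X in _ = _ * (_ + X)](big_geq (leqnn _)) mul1r.
move: IH; move: (\sum_(0 <= e < d.+1) _) => S.
move: (\prod_(_ <= c < _) fac c x) (\prod_(_ <= c < _) fac c y) => p q IH.
transitivity ((y * p - x * q) * fac (l.+1 + d).+1 y
  + (y - x) * (p * (y * b (l.+1 + d).+1))); first by rewrite /fac; ring.
by rewrite IH; ring.
Qed.

(** After the common factors are taken out, this is [fac_telescope] on the factors between the two
    exponents l and l + 1 + d, re-indexed by s = lam_(i+1) + e. *)
Lemma row_minor M lam (i : 'I_M) x y :
  (lam i.+1 <= lam i)%N -> (lam i <= B)%N -> y = Y M.+1 ->
  (x ^+ i * facs x (lam i + (M - i))) * (y ^+ i.+1 * facs y (lam i.+1 + (M - i.+1))) -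
  (x ^+ i.+1 * facs x (lam i.+1 + (M - i.+1))) * (y ^+ i * facs y (lam i + (M - i))) =
  (y - x) * ((y ^+ i * facs y (lam i.+1 + (M - i.+1))) *
    \sum_(s : 'I_B.+1 | @strip B _ lam i s)
      (x ^+ i * facs x (s + (M - i.+1))) * strip_wt1 M i (lam i) (lam i.+1) s).
Proof.
move=> lam_i lamB yE; have iM := ltn_ord i.
set l := (lam i.+1 + (M - i.+1))%N; pose d := (lam i - lam i.+1)%N.
have kE : (lam i + (M - i) = l.+1 + d)%N by rewrite /l /d; lia.
have lk : (l <= l.+1 + d)%N by lia.
rewrite kE (facs_cat x lk) (facs_cat y lk).
rewrite !exprS.
have -> : \sum_(s : 'I_B.+1 | @strip B _ lam i s) (x ^+ i * facs x (s + (M - i.+1))) *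
      strip_wt1 M i (lam i) (lam i.+1) s = x ^+ i * facs x l * \sum_(0 <= e < d.+1)
    (\prod_(l.+1 <= c < l.+1 + e) fac c x) *
    ((\prod_((l.+1 + e).+1 <= c < (l.+1 + d).+1) fac c y) *
     (if (0 < e)%N then y * b (l.+1 + e) else 1)).
  rewrite -(big_mkord (fun s => (lam i.+1 <= s <= lam i)%N)
    (fun s => (x ^+ i * facs x (s + (M - i.+1))) * strip_wt1 M i (lam i) (lam i.+1) s)).
  have -> : \sum_(0 <= s < B.+1 | (lam i.+1 <= s <= lam i)%N)
      (x ^+ i * facs x (s + (M - i.+1))) * strip_wt1 M i (lam i) (lam i.+1) s =
    \sum_(lam i.+1 <= s < (lam i).+1)
      (x ^+ i * facs x (s + (M - i.+1))) * strip_wt1 M i (lam i) (lam i.+1) s.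
    rewrite (@big_nat_widen _ _ _ _ (lam i).+1 B.+1) //.
    rewrite [RHS](@big_nat_widenl _ _ _ _ 0) //.
    by apply: eq_bigl => s; lia.
  rewrite -{1}[lam i.+1]add0n big_addn.
  have -> : ((lam i).+1 - lam i.+1 = d.+1)%N by rewrite /d; lia.
  rewrite mulr_sumr; apply: eq_big_nat => e e_d.
  have -> : (e + lam i.+1 + (M - i.+1) = l + e)%N by rewrite /l; lia.
  rewrite (@facs_cat x l (l + e)) ?leq_addr // -!mulrA; do 2 congr (_ * _).
  rewrite -addSn; congr (_ * _); rewrite /strip_wt1 -yE; congr (_ * _).
    have -> : ((l.+1 + e).+1 = (e + lam i.+1).+1 + (M - i))%N by rewrite /l; lia.
    have -> : ((l.+1 + d).+1 = (lam i).+1 + (M - i))%N by rewrite /l /d; lia.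
    rewrite big_addn addnK; apply: eq_big_nat => j _; congr fac; lia.
  rewrite -[X in (X < _)%N]add0n ltn_add2r; case: ifP => // _; congr (_ * b _).
  by rewrite /l; lia.
have := fac_telescope x y l d.
move: (\prod_(l.+1 <= c < _) fac c x) (\prod_(l.+1 <= c < _) fac c y) (\sum_(0 <= e < d.+1) _) => p q S E.
transitivity (x ^+ i * y ^+ i * facs x l * facs y l * (y * p - x * q)); first by ring.
by rewrite E; ring.
Qed.

(* Replacing row i by a combination with row i+1 clears the last column. *)
Lemma det_minors M (phi : nat -> nat -> A) :
  \det (\matrix_(i < M.+1, j < M.+1) phi i j) * \prod_(i < M) phi i.+1 M =
  phi M M * \det (\matrix_(i < M, j < M) (phi i j * phi i.+1 M - phi i.+1 j * phi i M)).
Proof.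
set X := \matrix_(i < M.+1, j < M.+1) _; set N := \matrix_(i < M, j < M) _.
pose T := \matrix_(i < M.+1, j < M.+1)
  (if (i < M)%N then (phi i.+1 M *+ (j == i :> nat)) - (phi i M *+ (j == i.+1 :> nat))
   else (j == i :> nat)%:R) : 'M[A]_M.+1.
have detT : \det T = \prod_(i < M) phi i.+1 M.
  rewrite -det_tr det_trig.
    rewrite big_ord_recr /= !mxE ltnn eqxx mulr1; apply: eq_bigr => i _.
    by rewrite !mxE /= ltn_ord eqxx mulr1n (_ : (i == i.+1 :> nat) = false) ?subr0 //; lia.
  apply/is_trig_mxP => i j ij; rewrite !mxE; case: ifP => _.
    have -> : (i == j :> nat) = false by lia.
    have -> : (i == j.+1 :> nat) = false by lia.
    by rewrite subr0.
  by have -> : (i == j :> nat) = false by lia.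
have TX i j : (T *m X) i j =
    if (i < M)%N then phi i.+1 M * phi i j - phi i M * phi i.+1 j else phi i j.
  rewrite mxE; case: ifP => iM.
    have iM1 : (i.+1 < M.+1)%N by lia.
    have E (k : 'I_M.+1) : T i k * X k j =
        (if k == i then phi i.+1 M * phi i j else 0) -
        (if k == Ordinal iM1 then phi i M * phi i.+1 j else 0).
      rewrite !mxE iM mulrBl -!(inj_eq val_inj) /=; congr (_ - _).
        by case: eqP => [->|]; rewrite ?mul0r ?mulr1n.
      by case: eqP => [->|]; rewrite ?mul0r ?mulr1n.
    by rewrite (eq_bigr _ (fun k _ => E k)) sumrB -!big_mkcond /= !big_pred1_eq.
  rewrite (bigD1 i) //= !mxE iM eqxx mul1r big1 ?addr0 // => k ki.
  by rewrite !mxE iM (_ : (k == i :> nat) = false) ?mul0r //; apply: negPf.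
rewrite mulrC -detT -det_mulmx (expand_det_col _ ord_max) big_ord_recr /= big1 ?add0r.
  rewrite TX ltnn /= /cofactor addnn -signr_odd odd_double expr0 mul1r; congr (_ * \det _).
  apply/matrixP => i j; rewrite !mxE.
  have e (k : 'I_M) : (lift ord_max k : nat) = k by rewrite lift_max.
  have := TX (lift ord_max i) (lift ord_max j); rewrite mxE !e ltn_ord => ->.
  by rewrite mulrC; congr (_ - _); rewrite mulrC.
move=> i _; rewrite TX /= ltn_ord.
by rewrite [X in _ - X]mulrC subrr mul0r.
Qed.

(** By [row_minor] each entry is a sum over a single part nu_i. Multilinearity in the rows, carried
    out in the Leibniz formula, turns the determinant into a sum over nu. The factors y - Y_j depend
    only on the column and come out of every term. *)
Lemma det_minors_expand M lam : (forall i, lam i.+1 <= lam i)%N -> (lam 0 <= B)%N ->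
  let y := Y M.+1 in
  \det (\matrix_(i < M, j < M)
    ((Y j.+1 ^+ i * facs (Y j.+1) (lam i + (M - i))) *
       (y ^+ i.+1 * facs y (lam i.+1 + (M - i.+1))) -
     (Y j.+1 ^+ i.+1 * facs (Y j.+1) (lam i.+1 + (M - i.+1))) *
       (y ^+ i * facs y (lam i + (M - i))))) =
  (\prod_(j < M) (y - Y j.+1)) * (\prod_(i < M) (y ^+ i * facs y (lam i.+1 + (M - i.+1)))) *
  \sum_(nu : {ffun 'I_M -> 'I_B.+1} | nu \in family (@strip B _ lam))
    (\prod_(i < M) strip_wt1 M i (lam i) (lam i.+1) (nu i)) * \det (alt_mx M (ffext nu)).
Proof.
move=> lam_dec lamB y; have lam_le i : (lam i <= B)%N.
  by elim: i => // i; apply: leq_trans.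
have D (X : 'M[A]_M) : \det X = \sum_(s : 'S_M) (-1) ^+ s * \prod_i X i (s i) by [].
rewrite [LHS]D; have E (nu : {ffun 'I_M -> 'I_B.+1}) :
    (\prod_(i < M) strip_wt1 M i (lam i) (lam i.+1) (nu i)) * \det (alt_mx M (ffext nu)) =
    \sum_(s : 'S_M) (\prod_(i < M) strip_wt1 M i (lam i) (lam i.+1) (nu i)) *
      ((-1) ^+ s * \prod_i alt_mx M (ffext nu) i (s i)) by rewrite D big_distrr.
rewrite (eq_bigr _ (fun (nu : {ffun 'I_M -> 'I_B.+1}) _ => E nu)).
rewrite exchange_big /= big_distrr /=; apply: eq_bigr => s _.
under eq_bigr => i _ do rewrite mxE (row_minor _ (lam_dec i) (lam_le i) erefl).
rewrite !big_split /= bigA_distr_big_dep /= -/y.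
have -> : \prod_i (y - Y (s i).+1) = \prod_(j < M) (y - Y j.+1).
  by rewrite [RHS](reindex_inj (@perm_inj _ s)).
rewrite !big_distrr /=; apply: eq_bigr => nu _; rewrite big_split /=.
have -> : \prod_i alt_mx M (ffext nu) i (s i) =
    \prod_(i < M) (Y (s i).+1 ^+ i * facs (Y (s i).+1) (nu i + (M - i.+1))).
  by apply: eq_bigr => i _; rewrite mxE ffextE.
have shuffle (e a c p w : A) : e * (a * (c * (p * w))) = a * c * (w * (e * p)) by ring.
exact: shuffle.
Qed.

Hypothesis lregY : forall k, GRing.lreg (Y k).
Hypothesis lreg_fac : forall k c, GRing.lreg (fac c (Y k)).

Theorem gt_sum_det M lam : (forall i, lam i.+1 <= lam i)%N -> (lam 0 <= B)%N ->
  gt_sum M lam * ydelta M = \det (alt_mx M lam).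
Proof.
elim: M lam => [|M IH] lam lam_dec lamB.
  by rewrite /ydelta big_ord0 mulr1 /= det_mx00.
set y := Y M.+1.
pose phi i j := Y j.+1 ^+ i * facs (Y j.+1) (lam i + (M - i)).
(* The product y^M E of the last-column entries below the top one is the factor that [det_minors]
   puts on the determinant. The other side contains it too: y^M from phi_(M,M) and E from the
   minors. *)
pose E : A := \prod_(i < M) (y ^+ i * facs y (lam i.+1 + (M - i.+1))).
have lregE : GRing.lreg (y ^+ M * E).
  apply: lregM; first by apply: lregX; exact: lregY.
  by apply: lreg_prod => i _; apply: lregM; [by apply: lregX; exact: lregY|apply: lreg_prod => j _; exact: lreg_fac].
apply: lregE.
have -> : alt_mx M.+1 lam = \matrix_(i < M.+1, j < M.+1) phi i j.
  by apply/matrixP => i j; rewrite !mxE /phi subSS.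
have phiE : \prod_(i < M) phi i.+1 M = y ^+ M * E.
  rewrite /E /phi -/y -[M in _ ^+ M](card_ord M) -prodr_const -big_split /=.
  by apply: eq_bigr => i _; rewrite exprS mulrA.
rewrite -phiE [RHS]mulrC det_minors phiE /phi -/y.
have X := det_minors_expand M lam_dec lamB; rewrite /= -/y -/E in X.
rewrite {}X.
set S := \sum_(nu | _) _.
suff key : gt_sum M.+1 lam * ydelta M = facs y (lam M) * S.
  rewrite subnn addn0 ydeltaS -/y [gt_sum _ _ * _]mulrA key.
  move: (\prod_(j < M) _) (facs y (lam M)) (y ^+ M) => p q r; ring.
rewrite /S mulr_sumr /= mulr_suml; apply: eq_bigr => nu /familyP nuP.
have nu_dec i : (ffext nu i.+1 <= ffext nu i)%N.
  have [iM|iM] := ltnP i.+1 M; last by rewrite ffext_out.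
  have i1 : (i < M)%N by lia.
  have : (lam i.+1 <= nu (Ordinal i1) <= lam i)%N := nuP (Ordinal i1).
  have : (lam i.+2 <= nu (Ordinal iM) <= lam i.+1)%N := nuP (Ordinal iM).
  rewrite [ffext nu i](ffextE nu (Ordinal i1)).
  by rewrite [ffext nu i.+1](ffextE nu (Ordinal iM)); lia.
have nuB : (ffext nu 0 <= B)%N.
  have [M0|M0] := posnP M; first by rewrite ffext_out ?M0.
  by rewrite (ffextE nu (Ordinal M0)) -ltnS.
rewrite -(IH _ nu_dec nuB) /strip_wt big_ord_recr /= ffext_out //.
(* In the last gap nu has the part 0, and its weight supplies the rest of phi_(M,M). *)
have -> : strip_wt1 M M (lam M) (lam M.+1) 0 = facs y (lam M).
  by rewrite /strip_wt1 ltn0 mulr1; apply: eq_bigr => j _; rewrite addnK.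
under eq_bigr do rewrite ffextE.
move: (\prod_(i < M) _) (facs y (lam M)) => p q; ring.
Qed.
End Branching.

(** * Rows of halfplane pipedreams *)

(* The column in which the i-th pipe (from the east, starting at 0) enters row
   -r, when the pipes entering that row are encoded by the partition lam. *)
Definition pos (lam : nat -> nat) (r i : nat) : int := (lam i)%:Z - i%:Z - r%:Z.

Definition noninc (lam : nat -> nat) := forall i, (lam i.+1 <= lam i)%N.
Definition il (lam nu : nat -> nat) := forall i, (lam i.+1 <= nu i <= lam i)%N.

Lemma il_noninc lam nu : il lam nu -> noninc nu.
Proof. by move=> h i; have := h i; have := h i.+1; lia. Qed.

Lemma noninc_le lam i j : noninc lam -> (i <= j)%N -> (lam j <= lam i)%N.
Proof.
move=> h /subnK <-; elim: (j - i)%N => //= k IH; exact: leq_trans (h _) IH.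
Qed.

Lemma pos_anti lam r i j : noninc lam -> (i < j)%N -> pos lam r j < pos lam r i.
Proof. by move=> h ij; have := noninc_le h (ltnW ij); rewrite /pos; lia. Qed.

Lemma pos_inj lam r : noninc lam -> injective (pos lam r).
Proof.
move=> h i j e; have [ij|ji|//] := ltngtP i j.
  by have := pos_anti r h ij; rewrite e ltxx.
by have := pos_anti r h ji; rewrite e ltxx.
Qed.

Lemma pos_il lam nu r i : il lam nu ->
  pos lam r i.+1 <= pos nu r.+1 i < pos lam r i.
Proof. by move=> h; have := h i; rewrite /pos; lia. Qed.

Variant pos_spec lam r (j : int) : Prop :=
| PosGt of pos lam r 0 < j
| PosEq of j = pos lam r 0
| PosIn i of pos lam r i.+1 <= j < pos lam r i.

Lemma posP lam r j : noninc lam -> pos_spec lam r j.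
Proof.
move=> h; have [gt|lt|e] := ltgtP (pos lam r 0) j; [exact: PosGt| |exact: PosEq].
pose P i := pos lam r i.+1 <= j.
have exP : exists i, P i.
  exists `|pos lam r 0 - j|%N.
  by have := noninc_le h (leq0n `|pos lam r 0 - j|.+1); move: lt; rewrite /P /pos; lia.
case: (ex_minnP exP) => i Pi imin; apply: (PosIn (i := i)); apply/andP; split=> //.
case: i Pi imin => // i _ imin; rewrite ltNge; apply/negP => Pi.
by have := imin i Pi; rewrite ltnn.
Qed.

Lemma pos_in_uniq lam r j i i' : noninc lam -> pos lam r i.+1 <= j < pos lam r i ->
  pos lam r i'.+1 <= j < pos lam r i' -> i = i'.
Proof.
move=> h hi hi'; have [lt|lt|//] := ltngtP i i'.
  have : (i.+1 <= i')%N by []; rewrite leq_eqVlt => /orP[/eqP e|/(pos_anti r h)]; last lia.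
  by subst i'; lia.
have : (i'.+1 <= i)%N by []; rewrite leq_eqVlt => /orP[/eqP e|/(pos_anti r h)]; last lia.
by subst i; lia.
Qed.

Lemma pos_in_lt0 lam r j i : noninc lam -> pos lam r i.+1 <= j < pos lam r i -> j < pos lam r 0.
Proof.
move=> h; case: i => [|i]; first by case/andP.
by have := @pos_anti lam r 0 i.+1 h isT; lia.
Qed.

(* The tiles of a pipe entering a row in column p and leaving it in column q,
   followed by empty tiles. *)
Definition pseg (p q j : int) : tile :=
  if j < q then if j == p then SEelbow else Horizontal
  else if j == q then if j == p then Vertical else NWelbow
  else Defs.Empty.

(** The eastmost pipe turns and runs off to the east, so pipe i + 1 of this row becomes pipe i of
    the next one. It has to turn up before the entry of pipe i, which is the interlacing
    condition. *)
Definition isrow lam nu r (R : int -> tile) : Prop :=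
  [/\ forall j, pos lam r 0 < j -> R j = Horizontal, R (pos lam r 0) = SEelbow &
   forall i j, pos lam r i.+1 <= j < pos lam r i ->
     R j = pseg (pos lam r i.+1) (pos nu r.+1 i) j].

Definition tile_row lam nu r (j : int) : tile :=
  if pos lam r 0 < j then Horizontal else if j == pos lam r 0 then SEelbow else
  let i := xget 0%N [set i | pos lam r i.+1 <= j < pos lam r i] in
  pseg (pos lam r i.+1) (pos nu r.+1 i) j.

Lemma row_isrow lam nu r : noninc lam -> isrow lam nu r (tile_row lam nu r).
Proof.
move=> h; rewrite /tile_row; split=> [j ->//||i j hi]; first by rewrite ltxx eqxx.
have lt := pos_in_lt0 h hi; rewrite ltNge (ltW lt) lt_eqF //=.
by case: xgetP => [k _ /= /(pos_in_uniq h hi) <-//|/(_ i)].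
Qed.

Lemma isrow_uniq lam nu r R : noninc lam -> isrow lam nu r R -> R = tile_row lam nu r.
Proof.
move=> h [R1 R2 R3]; have [S1 S2 S3] := row_isrow nu r h; apply/funext => j.
case: (posP r j h) => [gt|->|i hi]; first by rewrite R1 // S1.
  by rewrite R2 S2.
by rewrite (R3 i) // (S3 i).
Qed.

Section RowFacts.
Variables (lam nu : nat -> nat) (r : nat) (R : int -> tile).
Hypotheses (dec : noninc lam) (lam_nu : il lam nu) (rowR : isrow lam nu r R).

Lemma isrow_southP j : south (R j) <-> exists i, j = pos lam r i.
Proof.
case: rowR => R1 R2 R3; split.
  case: (posP r j dec) => [gt|->|i hi]; first by rewrite R1.
    by exists 0%N.
  rewrite (R3 i) // /pseg; case: (j =P pos lam r i.+1) => [->|_]; first by exists i.+1.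
  by do ?case: ifP.
case=> -[->|i ->]; first by rewrite R2.
rewrite (R3 i) ?lexx ?pos_anti // /pseg eqxx.
have q := pos_il r i lam_nu.
by case: (ltP (pos lam r i.+1)) => // h1; case: eqP => // h2; case: h2; lia.
Qed.

Lemma isrow_northP j : north (R j) <-> exists i, j = pos nu r.+1 i.
Proof.
case: rowR => R1 R2 R3; split.
  case: (posP r j dec) => [gt|->|i hi]; [by rewrite R1|by rewrite R2|].
  rewrite (R3 i) // /pseg; case: (j =P pos nu r.+1 i) => [->|_]; first by exists i.
  by do ?case: ifP.
case=> i ->; rewrite (R3 i); last exact: pos_il.
by rewrite /pseg ltxx eqxx; case: ifP.
Qed.

Lemma isrow_nocross j : R j <> Crossing.
Proof.
case: rowR => R1 R2 R3.
case: (posP r j dec) => [gt|->|i hi]; [by rewrite R1|by rewrite R2|].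
by rewrite (R3 i) // /pseg; do ?case: ifP.
Qed.

Lemma isrow_match j : east (R j) = west (R (j + 1)).
Proof.
case: rowR => R1 R2 R3.
have W0 i : west (R (pos lam r i)) = false.
  case: i => [|i]; first by rewrite R2.
  have /isrow_southP : exists i', pos lam r i.+1 = pos lam r i' by exists i.+1.
  rewrite (R3 i); last by rewrite lexx pos_anti.
  by rewrite /pseg eqxx; do ?case: ifP.
case: (posP r j dec) => [gt|->|i hi]; first by rewrite !R1 //; lia.
  by rewrite R2 R1 //; lia.
have q := pos_il r i lam_nu.
have [e|ne] := eqVneq (j + 1) (pos lam r i).
  rewrite e W0 (R3 i) // /pseg; do ?case: ifP => //; move: e q; lia.
rewrite (R3 i) // (R3 i); last by move: hi ne; lia.
rewrite /pseg; case: (ltP j) => h1.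
  case: (ltP (j + 1)) => h2.
    by case: eqP => e1; case: eqP => e2 //; move: hi; lia.
  have -> : (j + 1 == pos nu r.+1 i) by apply/eqP; lia.
  have -> : (j + 1 == pos lam r i.+1) = false by apply/eqP; lia.
  by case: ifP.
have -> : (j + 1 < pos nu r.+1 i) = false by lia.
have -> : (j + 1 == pos nu r.+1 i) = false by lia.
by case: ifP => // _; case: ifP.
Qed.

Lemma isrow_emptyP j : R j = Defs.Empty <-> exists i, pos nu r.+1 i < j < pos lam r i.
Proof.
case: rowR => R1 R2 R3; split.
  case: (posP r j dec) => [gt|->|i hi]; [by rewrite R1|by rewrite R2|].
  rewrite (R3 i) // /pseg => h; exists i; move: h hi.
  by case: ltP => [_|h1]; [case: ifP|case: eqP => [_|h2]; [case: ifP|lia]].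
case=> i hi; have q := pos_il r i lam_nu; rewrite (R3 i); last by lia.
rewrite /pseg; have -> : (j < pos nu r.+1 i) = false by lia.
by have -> : (j == pos nu r.+1 i) = false by lia.
Qed.

Lemma isrow_NWP j : R j = NWelbow <->
  exists2 i, (lam i.+1 < nu i)%N & j = pos nu r.+1 i.
Proof.
case: rowR => R1 R2 R3; split.
  case: (posP r j dec) => [gt|->|i hi]; [by rewrite R1|by rewrite R2|].
  rewrite (R3 i) // /pseg => h; exists i; move: h hi; have := lam_nu i.
    case: ltP => [_|h1]; first by case: ifP.
    by case: eqP => [->|_] //; case: eqP => // ne; move: ne; rewrite /pos; lia.
  by case: ltP => [_|h1]; [case: ifP|case: eqP].
case=> i lt ->; rewrite (R3 i); last exact: pos_il.
by rewrite /pseg ltxx eqxx; case: eqP => //; rewrite /pos; lia.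
Qed.

Lemma isrow_noempty : (forall j, R j <> Defs.Empty) -> nu = lam.
Proof.
move=> ne; apply/funext => i; have [lt|ge] := ltnP (nu i) (lam i); last first.
  by apply/eqP; rewrite eqn_leq ge; have /andP[_ ->] := lam_nu i.
case: (ne (pos lam r i - 1)); apply/isrow_emptyP; exists i.
by move: lt; rewrite /pos; lia.
Qed.
End RowFacts.

Lemma row_inj lam nu nu' r : noninc lam -> il lam nu -> il lam nu' ->
  tile_row lam nu r = tile_row lam nu' r -> nu = nu'.
Proof.
move=> h hn hn' e; apply/funext => i.
have R1 := row_isrow nu r h; have R2 := row_isrow nu' r h; rewrite -e in R2.
have /(isrow_northP h hn R1) : exists i', pos nu r.+1 i = pos nu r.+1 i' by exists i.
case: R2 => _ _ R3; rewrite (R3 i); last exact: pos_il.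
by rewrite /pseg; case: ltP => [_|_]; [case: ifP|case: eqP => //; rewrite /pos; lia].
Qed.

(** * Every admissible row comes from an interlacing pair *)

Section RowDetermined.
Variable R : int -> tile.
Hypothesis match_h : forall j, east (R j) = west (R (j + 1)).
Hypothesis nocross : forall j, R j <> Crossing.

Lemma tiles_empty_after j n : east (R j) = false ->
  (forall k : nat, (k < n)%N -> south (R (j + 1 + k%:Z)) = false) ->
  forall k : nat, (k < n)%N -> R (j + 1 + k%:Z) = Defs.Empty.
Proof.
move=> ej ns; elim=> [|k IH] kn.
  move: (ns _ kn); rewrite addr0 in ns *; have := match_h j; rewrite ej.
  by case: (R (j + 1)).
have := ns _ kn; have := match_h (j + 1 + k%:Z); rewrite IH 1?ltnW //.
have -> : j + 1 + k%:Z + 1 = j + 1 + k.+1%:Z by lia.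
by case: (R _).
Qed.

Lemma tiles_run n k : west (R k) -> west (R (k + n%:Z)) = false ->
  (forall i : nat, (i < n)%N -> south (R (k + i%:Z)) = false) ->
  exists2 q : int, k <= q < k + n%:Z & [/\ R q = NWelbow,
    forall j : int, k <= j < q -> R j = Horizontal &
    forall j : int, q < j < k + n%:Z -> R j = Defs.Empty].
Proof.
elim: n k => [|n IH] k wk wn ns; first by move: wn; rewrite addr0 wk.
have ns0 := ns 0%N isT; rewrite addr0 in ns0.
have [NW|H] : R k = NWelbow \/ R k = Horizontal.
  by move: wk ns0 (@nocross k); case: (R k) => //; auto.
  exists k; first by lia.
  split=> // j hj; first by lia.
  have := @tiles_empty_after k n; rewrite NW => /(_ erefl).
  have -> : j = k + 1 + (absz (j - k - 1)%R)%:Z by lia.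
  apply; last by lia.
  move=> i i_n; have := ns i.+1; have -> : k + i.+1%:Z = k + 1 + i%:Z by lia.
  by apply.
have e : k + n.+1%:Z = k + 1 + n%:Z by lia.
case: (IH (k + 1)).
- by rewrite -match_h H.
- by rewrite -e.
- move=> i i_n; have := ns i.+1; have -> : k + i.+1%:Z = k + 1 + i%:Z by lia.
  by apply.
move=> q hq [q1 q2 q3]; exists q; first by lia.
split=> // j hj; last by apply: q3; lia.
by have [->//|ne] := eqVneq j k; apply: q2; lia.
Qed.

Lemma tiles_seg (p p' : int) : p < p' -> south (R p) -> west (R p') = false ->
  (forall j : int, p < j < p' -> south (R j) = false) ->
  exists2 q : int, p <= q < p' & forall j : int, p <= j < p' -> R j = pseg p q j.
Proof.
move=> pp' sp wp' ns.
have [V|SE] : R p = Vertical \/ R p = SEelbow.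
  by move: sp (@nocross p); case: (R p) => //; auto.
  exists p; first by lia.
  move=> j hj; rewrite /pseg; have [->|ne] := eqVneq j p; first by rewrite ltxx.
  have -> : (j < p) = false by lia.
  have := @tiles_empty_after p (absz (p' - p - 1)%R); rewrite V => /(_ erefl).
  have -> : j = p + 1 + (absz (j - p - 1)%R)%:Z by lia.
  by apply; [move=> k kn; apply: ns|]; lia.
case: (@tiles_run (absz (p' - p - 1)%R) (p + 1)).
- by rewrite -match_h SE.
- by have -> : p + 1 + (absz (p' - p - 1)%R)%:Z = p' by lia.
- by move=> i i_n; apply: ns; lia.
have -> : p + 1 + (absz (p' - p - 1)%R)%:Z = p' by lia.
move=> q hq [q1 q2 q3]; exists q; first by lia.
move=> j hj; rewrite /pseg; case: (ltP j q) => h.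
  by case: eqP => [->//|ne]; apply: q2; lia.
case: (j =P q) => [->|ne]; first by case: eqP => // e; move: hq; lia.
by apply: q3; lia.
Qed.

(** Between consecutive entries there is a single pipe, and it must leave north, since without
    crossings the next entry blocks the way east. From the eastmost entry on, no tile can fail to
    pass a pipe east, or all tiles further east would be empty. *)
Lemma tiles_row lam r : noninc lam ->
  (forall j, south (R j) <-> exists i, j = pos lam r i) ->
  (exists j0, forall j, j0 <= j -> west (R j)) ->
  exists2 nu, il lam nu & isrow lam nu r R.
Proof.
move=> h sP [j0 wj0].
have Spos i : south (R (pos lam r i)) by apply/sP; exists i.
have Wpos i : west (R (pos lam r i)) = false.
  by move: (Spos i) (@nocross (pos lam r i)); case: (R _).
have noS i j : pos lam r i.+1 < j < pos lam r i -> south (R j) = false.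
  move=> hj; apply/negP => /sP[k e]; subst j.
  have [k1 k2] : (k < i.+1)%N /\ (i < k)%N.
    split; rewrite ltnNge; apply/negP; rewrite leq_eqVlt => /orP[/eqP e|/(pos_anti r h)]; try lia;
    by subst; lia.
  by move: k1 k2; lia.
have noS0 j : pos lam r 0 < j -> south (R j) = false.
  move=> hj; apply/negP => /sP[[|k] e]; subst j; first by lia.
  by have := @pos_anti lam r 0 k.+1 h isT; lia.
have stop j : pos lam r 0 <= j -> east (R j) = false -> False.
  move=> pj ej; pose k := absz (j0 - j)%R.
  have E : R (j + 1 + k%:Z) = Defs.Empty.
    by apply: (@tiles_empty_after j k.+1 ej) => // i _; apply: noS0; lia.
  have /wj0 : j0 <= j + 1 + k%:Z by rewrite /k; lia.
  by rewrite E.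
have E0 : R (pos lam r 0) = SEelbow.
  have := Spos 0%N; have := @stop (pos lam r 0) (lexx _); have := @nocross (pos lam r 0).
  by case: (R _) => //= _ /(_ erefl).
have H (k : nat) : R (pos lam r 0 + 1 + k%:Z) = Horizontal.
  elim: k => [|k IH].
    rewrite addr0; have := match_h (pos lam r 0); rewrite E0 /=.
    have := @stop (pos lam r 0 + 1); have := @noS0 (pos lam r 0 + 1).
    have := @nocross (pos lam r 0 + 1).
    case: (R _) => //= _ _ /(_ _ erefl) s _; exfalso; apply: s; lia.
  have := match_h (pos lam r 0 + 1 + k%:Z); rewrite IH /=.
  have -> : pos lam r 0 + 1 + k%:Z + 1 = pos lam r 0 + 1 + k.+1%:Z by lia.
  have := @stop (pos lam r 0 + 1 + k.+1%:Z); have := @nocross (pos lam r 0 + 1 + k.+1%:Z).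
  case: (R _) => //= _ /(_ _ erefl) s _; exfalso; apply: s; lia.
have ex i : exists v : nat, (lam i.+1 <= v <= lam i)%N /\
    forall j, pos lam r i.+1 <= j < pos lam r i ->
      R j = pseg (pos lam r i.+1) (v%:Z - i%:Z - r.+1%:Z) j.
  have [q hq Rq] := tiles_seg (pos_anti r h (ltnSn i)) (Spos i.+1) (Wpos i) (noS i).
  exists (absz (q + i%:Z + r.+1%:Z)%R); split; first by move: hq; rewrite /pos; lia.
  move=> j /Rq ->; congr pseg; move: hq; rewrite /pos; lia.
have [nu nuP] := choice ex; exists nu; first by move=> i; case: (nuP i).
split=> // [j hj|i j]; last by case: (nuP i) => _; apply.
have := H (absz (j - pos lam r 0 - 1)%R).
by have -> : pos lam r 0 + 1 + (absz (j - pos lam r 0 - 1)%R)%:Z = j by lia.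
Qed.
End RowDetermined.

(** * Halfplane pipedreams and Gelfand-Tsetlin patterns *)

Definition tcons (R : int -> tile) (D : tiling) : tiling :=
  fun k => if k is k'.+1 then D k' else R.

Definition tbehead (D : tiling) : tiling := fun k => D k.+1.

Lemma tcons_behead D : tcons (D 0%N) (tbehead D) = D.
Proof. by apply/funext => -[]. Qed.

(** The tiling of the empty partition: each pipe goes straight up to the diagonal and turns east
    there. *)
Definition ground (r : nat) : tiling := fun k => tile_row (fun=> 0%N) (fun=> 0%N) (r + k).

(* The pipes entering from the south are encoded by lam, assumed to be supported
   on [0, M); the rows of index at least M contain no empty tile and no NW
   elbow. *)
Fixpoint tilings (B M : nat) (lam : nat -> nat) (r : nat) : seq tiling :=
  if M is M'.+1 then
    [seq tcons (tile_row lam (ffext nu) r) D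
    | nu <- enum (family (@strip B M' lam)), D <- tilings B M' (ffext nu) r.+1]
  else [:: ground r].

(** What is left of a pipedream when its r southern rows are removed. Condition (3) is weakened to
    [pt_west], which is inherited when a row is removed and suffices to determine the rows. *)
Record pipe_tiling (lam : nat -> nat) (r : nat) (D : tiling) : Prop := {
  pt_match_h : forall k j, east (D k j) = west (D k (j + 1));
  pt_match_v : forall k j, north (D k j) = south (D k.+1 j);
  pt_nocross : forall k j, D k j <> Crossing;
  pt_west : forall k, exists j0 : int, forall j : int, j0 <= j -> west (D k j);
  pt_south : forall j, south (D 0%N j) <-> exists i, j = pos lam r i
}.

Lemma pipe_tiling_step lam r D : noninc lam -> pipe_tiling lam r D ->
  exists nu, [/\ il lam nu, isrow lam nu r (D 0%N) & pipe_tiling nu r.+1 (tbehead D)].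
Proof.
move=> h [mh mv nc we so].
have [nu lam_nu rowD] := tiles_row (mh 0%N) (nc 0%N) h so (we 0%N).
exists nu; split=> //; split=> // [k j|k j|k j|k|j]; rewrite /tbehead //.
by rewrite -mv; apply: isrow_northP h lam_nu rowD j.
Qed.

Lemma tilingsS B M lam r D : (D \in tilings B M.+1 lam r) <->
  exists2 nu : {ffun 'I_M -> 'I_B.+1}, nu \in family (strip lam) &
  exists2 D', D' \in tilings B M (ffext nu) r.+1 & D = tcons (tile_row lam (ffext nu) r) D'.
Proof.
split=> [/allpairsPdep[nu [D' [nuP D'P ->]]]|[nu nuP [D' D'P ->]]].
  by exists nu; [rewrite mem_enum in nuP|exists D'].
by apply/allpairsPdep; exists nu, D'; split=> //; rewrite mem_enum.
Qed.

Lemma strip_il B M lam (nu : {ffun 'I_M -> 'I_B.+1}) :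
  (forall i, (M < i)%N -> lam i = 0%N) -> nu \in family (strip lam) -> il lam (ffext nu).
Proof.
move=> supp /familyP nuP i; have [iM|iM] := ltnP i M.
  by rewrite (ffextE nu (Ordinal iM)); apply: (nuP (Ordinal iM)).
by rewrite ffext_out // supp.
Qed.

Lemma ffext_surj B M nu : (forall i, nu i <= B)%N -> (forall i, (M <= i)%N -> nu i = 0%N) ->
  exists f : {ffun 'I_M -> 'I_B.+1}, ffext f = nu.
Proof.
move=> nuB supp; exists [ffun i : 'I_M => inord (nu i)]; apply/funext => i.
have [iM|iM] := ltnP i M; last by rewrite ffext_out // supp.
by rewrite (ffextE _ (Ordinal iM)) ffunE inordK // ltnS.
Qed.

Lemma tilings_step B M lam nu r D : noninc lam -> il lam nu -> (lam 0 <= B)%N ->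
  (forall i, (M <= i)%N -> nu i = 0%N) -> isrow lam nu r (D 0%N) ->
  tbehead D \in tilings B M nu r.+1 -> D \in tilings B M.+1 lam r.
Proof.
move=> h lam_nu lamB supp rowD D'P.
have nuB i : (nu i <= B)%N.
  by have := lam_nu i; have := noninc_le h (leq0n i); lia.
have [f fE] := ffext_surj nuB supp.
apply/tilingsS; exists f.
  by apply/familyP => i; rewrite inE /= -ffextE fE; exact: lam_nu.
exists (tbehead D); first by rewrite fE.
by rewrite fE -(isrow_uniq h rowD) tcons_behead.
Qed.

Lemma pipe_tiling0_ground lam r D k : (forall i, lam i = 0%N) -> pipe_tiling lam r D ->
  D k = tile_row (fun=> 0%N) (fun=> 0%N) (r + k).
Proof.
elim: k lam r D => [|k IH] lam r D lam0 ptD.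
  have h : noninc lam by move=> i; rewrite !lam0.
  have [nu [lam_nu rowD _]] := pipe_tiling_step h ptD.
  have lamE : lam = fun=> 0%N by apply/funext.
  have nuE : nu = fun=> 0%N.
    by apply/funext => i; have := lam_nu i; rewrite !lam0; lia.
  by rewrite addn0 (isrow_uniq h rowD) lamE nuE.
have h : noninc lam by move=> i; rewrite !lam0.
have [nu [lam_nu _ ptD']] := pipe_tiling_step h ptD.
rewrite -addSnnS; apply: IH ptD' => i.
by have := lam_nu i; rewrite !lam0; lia.
Qed.

Lemma pipe_tiling0_tilings B M lam r D : (forall i, lam i = 0%N) ->
  pipe_tiling lam r D -> D \in tilings B M lam r.
Proof.
elim: M lam r D => [|M IH] lam r D lam0 ptD.
  rewrite inE; apply/eqP/funext => k; exact: pipe_tiling0_ground lam0 ptD.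
have h : noninc lam by move=> i; rewrite !lam0.
have [nu [lam_nu rowD ptD']] := pipe_tiling_step h ptD.
have nu0 i : nu i = 0%N by have := lam_nu i; rewrite !lam0; lia.
by apply: (tilings_step h lam_nu _ _ rowD) => //; [rewrite lam0|exact: IH].
Qed.

(** Without empty tiles all rows have the same partition, and its last nonzero part produces a NW
    elbow in each of them: the infinite staircase. *)
Lemma pipe_tiling_noempty lam r D k : noninc lam -> (exists L, lam L = 0%N) ->
  pipe_tiling lam r D -> (forall k j, D k j <> Defs.Empty) -> lam 0%N != 0%N ->
  exists j, D k j = NWelbow.
Proof.
elim: k lam r D => [|k IH] lam r D h fin ptD ne lam0;
    have [nu [lam_nu rowD ptD']] := pipe_tiling_step h ptD;
    have nuE := isrow_noempty h lam_nu rowD (ne 0%N); subst nu; last first.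
  by apply: (IH lam r.+1 (tbehead D)) => // k' j; exact: ne.
case: (ex_minnP (P := fun L => lam L == 0%N)).
  by case: fin => L lL; exists L; apply/eqP.
case=> [|L] /eqP l0 Lmin; first by rewrite l0 in lam0.
exists (pos lam r.+1 L); apply/(isrow_NWP h lam_nu rowD); exists L => //.
by rewrite l0 lt0n; apply/negP => /Lmin; rewrite ltnn.
Qed.

(** From row K on there are no empty tiles, so finiteness of the NW elbows forces the empty
    partition there. At each of the K steps before, the rows still available must be at least as
    many as the L possible parts, whence K + L. *)
Lemma pipe_tiling_tilings B K L M lam r D : noninc lam -> (lam 0 <= B)%N ->
  (forall i, (L <= i)%N -> lam i = 0%N) -> pipe_tiling lam r D ->
  (forall k j, (K <= k)%N -> D k j <> Defs.Empty) ->
  (exists N, forall k j, (N <= k)%N -> D k j <> NWelbow) ->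
  (K + L <= M)%N -> D \in tilings B M lam r.
Proof.
elim: K lam r D M => [|K IH] lam r D M h lamB supp ptD ne [N nw] KLM.
  have lam0 : lam 0%N = 0%N.
    apply/eqP; apply: contraT => l0.
    have [] := @pipe_tiling_noempty lam r D N h _ ptD _ l0.
    - by exists L; rewrite supp.
    - by move=> k j; apply: ne.
    - by move=> j e; case: (nw N j (leqnn N) e).
  apply: pipe_tiling0_tilings => // i.
  by have := noninc_le h (leq0n i); rewrite lam0; lia.
have [nu [lam_nu rowD ptD']] := pipe_tiling_step h ptD.
have nu0 i : (L <= i)%N -> nu i = 0%N by move=> /supp li; have := lam_nu i; rewrite li; lia.
case: M KLM => // M KLM; apply: (tilings_step h lam_nu lamB _ rowD).
  by move=> i Mi; apply: nu0; lia.
apply: IH => //; first exact: il_noninc lam_nu.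
- by have := lam_nu 0%N; lia.
- by move=> k j Kk; apply: ne.
- by exists N => k j Nk; apply: nw; lia.
Qed.

Lemma pipe_tiling_empty_bound lam r D k j : noninc lam -> pipe_tiling lam r D ->
  D k j = Defs.Empty -> j < (lam 0%N)%:Z - r%:Z - k%:Z.
Proof.
elim: k lam r D => [|k IH] lam r D h ptD;
    have [nu [lam_nu rowD ptD']] := pipe_tiling_step h ptD.
  move/(isrow_emptyP h lam_nu rowD) => [i hi].
  by have := noninc_le h (leq0n i); move: hi; rewrite /pos; lia.
move=> e; have := IH nu r.+1 (tbehead D) (il_noninc lam_nu) ptD' e.
by have := lam_nu 0%N; lia.
Qed.

Lemma tilings_chain B M lam r D : noninc lam -> (forall i, (M <= i)%N -> lam i = 0%N) ->
  D \in tilings B M lam r -> exists c : nat -> nat -> nat,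
  [/\ c 0%N = lam, forall k, noninc (c k), forall k, il (c k) (c k.+1) &
      forall k, D k = tile_row (c k) (c k.+1) (r + k)].
Proof.
elim: M lam r D => [|M IH] lam r D h supp.
  rewrite inE => /eqP ->; exists (fun _ _ => 0%N); split=> //.
  by apply/funext => i; rewrite supp.
case/tilingsS => nu nuP [D' D'P ->].
have lam_nu := strip_il supp nuP; have nu_h := il_noninc lam_nu.
have [|c [c0 ch cil cD]] := IH (ffext nu) r.+1 D' nu_h _ D'P.
  by move=> i Mi; rewrite ffext_out.
exists (fun k => if k is k'.+1 then c k' else lam); split=> // [[|k]|[|k]|[|k]] //=.
- by rewrite c0.
- by rewrite addn0 c0.
- by rewrite addnS -addSn cD.
Qed.

Lemma uniq_tilings B M lam r : noninc lam -> (forall i, (M <= i)%N -> lam i = 0%N) ->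
  uniq (tilings B M lam r).
Proof.
elim: M lam r => [|M IH] lam r h supp //=.
apply: allpairs_uniq_dep; first exact: enum_uniq.
  move=> nu; rewrite mem_enum => nuP; apply: IH.
    exact: il_noninc (strip_il supp nuP).
  by move=> i Mi; rewrite ffext_out.
move=> _ _ /allpairsPdep[nu [D [nuP _ ->]]] /allpairsPdep[nu' [D' [nuP' _ ->]]] /= e.
rewrite !mem_enum in nuP nuP'.
have e0 := congr1 (fun T : tiling => T 0%N) e.
have eD : D = D' by apply/funext => k; exact: (congr1 (fun T : tiling => T k.+1) e).
have en := row_inj h (strip_il supp nuP) (strip_il supp nuP') e0.
have -> : nu = nu'.
  by apply/ffunP => i; apply: val_inj; rewrite /= -!ffextE en.
by rewrite eD.
Qed.

Lemma pipe_edge D c k j e :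
  (forall k j, east (D k j) = west (D k (j + 1))) ->
  (forall k j, north (D k j) = south (D k.+1 j)) ->
  pipe D c k j e -> if e is FromSouth then south (D k j) else west (D k j).
Proof.
move=> mh mv; elim=> {k j e} // k j _.
- by move=> _ e; rewrite -mh e.
- by move=> _ e; rewrite -mv e.
- by move=> _ [] e; rewrite -mv e.
- by move=> _ [] e; rewrite -mh e.
Qed.

Section ChainPipes.
Variables (D : tiling) (c : nat -> nat -> nat).
Hypothesis ch : forall k, noninc (c k).
Hypothesis cil : forall k, il (c k) (c k.+1).
Hypothesis cD : forall k, D k = tile_row (c k) (c k.+1) k.

Let rowD k : isrow (c k) (c k.+1) k (D k).
Proof. by rewrite cD; apply: row_isrow. Qed.

(** Each row sheds its eastmost pipe, so the numbering from the east drops by one per row. *)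
Lemma chain_pipe k i : pipe D (pos (c 0%N) 0 (k + i)) k (pos (c k) k i) FromSouth.
Proof.
elim: k i => [|k IH] i.
  by apply: pipe_start; apply/(isrow_southP (ch 0) (cil 0) (rowD 0)); exists i.
rewrite addSnnS; have := IH i.+1; move: (pos (c 0%N) 0 (k + i.+1)) => c0 Hp.
case: (rowD k) => _ _ R3.
have q := pos_il k i (cil k).
set p := pos (c k) k i.+1 in Hp q *; set p' := pos (c k.+1) k.+1 i in q *.
have tileE j : p <= j <= p' -> D k j = pseg p p' j by move=> hj; apply: R3; lia.
have [e|ne] := eqVneq p p'.
  rewrite -e; apply: pipe_up Hp _; left.
  rewrite tileE; last by rewrite -e !lexx.
  by rewrite -e /pseg ltxx eqxx.
have Hw (n : nat) : p + 1 + n%:Z <= p' -> pipe D c0 k (p + 1 + n%:Z) FromWest.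
  elim: n => [|n IHn] hn.
    rewrite addr0; apply: pipe_SE Hp _; rewrite tileE; last by lia.
    by rewrite /pseg eqxx; have -> : p < p' by lia.
  have -> : p + 1 + n.+1%:Z = p + 1 + n%:Z + 1 by lia.
  apply: pipe_right; first by apply: IHn; lia.
  left; rewrite tileE; last by lia.
  rewrite /pseg; have -> : p + 1 + n%:Z < p' by lia.
  by have -> : (p + 1 + n%:Z == p) = false by lia.
apply: pipe_NW; last first.
  rewrite tileE; last by lia.
  by rewrite /pseg ltxx eqxx; have -> : (p' == p) = false by lia.
have := Hw (absz (p' - p - 1)%R); have -> : p + 1 + (absz (p' - p - 1)%R)%:Z = p' by lia.
by apply; lia.
Qed.

Lemma chain_heads_east k : heads_east D (pos (c 0%N) 0 k) k.
Proof.
case: (rowD k) => R1 R2 _; have Hp := chain_pipe k 0; rewrite addn0 in Hp.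
exists (pos (c k) k 0 + 1) => j hj.
have -> : j = pos (c k) k 0 + 1 + (absz (j - pos (c k) k 0 - 1)%R)%:Z by lia.
elim: (absz _) => [|n IHn]; first by rewrite addr0; apply: pipe_SE Hp R2.
have -> : pos (c k) k 0 + 1 + n.+1%:Z = pos (c k) k 0 + 1 + n%:Z + 1 by lia.
by apply: pipe_right IHn _; left; apply: R1; lia.
Qed.
End ChainPipes.

(** * Halfplane pipedreams as pipe tilings *)

Section Correspondence.
Variables (lam : seq nat) (lam_part : is_partition lam).
Local Notation l := (fun i => nth 0%N lam i).

Lemma part_noninc : noninc l.
Proof. by move=> i; apply: nth_partition_le. Qed.

(** Together the two conditions say that the set of entries is the image of the nonpositive integers
    under w, which [w_part_opp] computes. *)
Lemma entriesP D :
  (entries D `&` [set c | 0 < c] = I_plus (w_part lam) /\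
   [set c | c <= 0] `\` entries D = I_minus (w_part lam)) <->
  forall j, south (D 0%N j) <-> exists i, j = pos l 0 i.
Proof.
have wb := w_part_bij lam; have wI := bij_inj wb.
have posE i : pos l 0 i = w_part lam (- i%:Z) by rewrite w_part_opp // /pos subr0.
have inP j : (w_part lam @` [set i | i <= 0]) j <-> exists i, j = pos l 0 i.
  split=> [[i /= i0 <-]|[i ->]].
    by exists (absz i); rewrite posE; congr w_part; lia.
  by exists (- i%:Z); [rewrite /=; lia|rewrite posE].
have outP j : (w_part lam @` [set i | 0 < i]) j <-> ~ exists i, j = pos l 0 i.
  rewrite -inP; split=> [[i /= i0 <-] [i' /= i'0 /wI e]|no]; first by lia.
  case: wb => w' wK w'K; exists (w' j); last by rewrite w'K.
  by rewrite /= ltNge; apply/negP => h; apply: no; exists (w' j); rewrite ?w'K.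
split=> [[ep em] j|H].
  have [j0|j0] := ltP 0 j.
    have := congr1 (fun S : set int => S j) ep; rewrite /I_plus /entries /= => E.
    split=> [s|/inP s].
      by apply/inP; have : (south (D 0%N j) /\ 0 < j) by []; rewrite E => -[].
    by have : (0 < j /\ (w_part lam @` [set i | i <= 0]) j) by []; rewrite -E => -[].
  have := congr1 (fun S : set int => S j) em; rewrite /I_minus /entries /= => E.
  split=> [s|ex].
    apply: contrapT => /outP s'.
    by have : (j <= 0 /\ (w_part lam @` [set i | 0 < i]) j) by []; rewrite -E => -[].
  apply: contrapT => ns.
  by have : (j <= 0 /\ ~ south (D 0%N j)) by []; rewrite E => -[_ /outP].
split; apply/seteqP; split=> j /=; rewrite /I_plus /I_minus /entries /=.
- by move=> [/H s j0]; split=> //; apply/inP.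
- by move=> [j0 /inP s]; split=> //; apply/H.
- by move=> [j0 ns]; split=> //; apply/outP => s; apply: ns; apply/H.
- by move=> [j0 /outP s]; split=> // /H.
Qed.

Lemma card_entries_gt k :
  ([set c' | (exists i, c' = pos l 0 i) /\ (pos l 0 k < c')%R] #= `I_k)%card.
Proof.
have h := part_noninc.
have -> : [set c' | (exists i, c' = pos l 0 i) /\ (pos l 0 k < c')%R] = pos l 0 @` `I_k.
  apply/seteqP; split=> c /=.
    move=> [[i ->] lt]; exists i => //; rewrite /= ltnNge leq_eqVlt.
    by apply/negP => /orP[/eqP e|/(pos_anti 0 h)]; [move: lt; rewrite e ltxx|move: lt; lia].
  by move=> [i ik <-]; split; [exists i|exact: pos_anti].
by apply: inj_card_eq => i j _ _; exact: pos_inj.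
Qed.

Lemma hp_pipe_tiling D : halfplane_pipedream lam D -> pipe_tiling l 0 D.
Proof.
case=> mh mv nc ep em he _; have /entriesP so := conj ep em.
split=> // k; have entE : entries D = [set c | exists i, c = pos l 0 i].
  by apply/seteqP; split=> j /so.
(* The pipe with exactly k pipes to its east is the one sent off to the east in row -k. *)
have [] := he k (pos l 0 k).
- by apply/so; exists k.
- by rewrite entE; exact: card_entries_gt.
by move=> j0 Hj0; exists j0 => j /Hj0; exact: (pipe_edge mh mv).
Qed.

Lemma tilings_hp B M D : (size lam <= M)%N -> D \in tilings B M l 0 ->
  finite_set [set kj : nat * int | D kj.1 kj.2 = Defs.Empty \/ D kj.1 kj.2 = NWelbow] ->
  halfplane_pipedream lam D.
Proof.
move=> lM DP fin; have h := part_noninc.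
have [|c [c0 ch cil cD]] := tilings_chain h _ DP.
  by move=> i Mi; rewrite nth_default // (leq_trans lM).
have {}cD k : D k = tile_row (c k) (c k.+1) k by rewrite cD.
have rowD k : isrow (c k) (c k.+1) k (D k) by rewrite cD; apply: row_isrow.
have so j : south (D 0%N j) <-> exists i, j = pos l 0 i.
  by have := isrow_southP (ch 0%N) (cil 0%N) (rowD 0%N) j; rewrite c0.
have [ep em] := (entriesP D).2 so.
split=> //.
- by move=> k j; apply: isrow_match (ch k) (cil k) (rowD k) j.
- move=> k j; apply/idP/idP.
    by move/(isrow_northP (ch k) (cil k) (rowD k)) => e; apply/(isrow_southP (ch k.+1) (cil k.+1) (rowD k.+1)).
  by move/(isrow_southP (ch k.+1) (cil k.+1) (rowD k.+1)) => e; apply/(isrow_northP (ch k) (cil k) (rowD k)).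
- by move=> k j; apply: isrow_nocross (ch k) (rowD k) j.
move=> k x /so[i ->].
have entE : entries D = [set c | exists i, c = pos l 0 i].
  by apply/seteqP; split=> j /so.
rewrite entE => ck; have ci := card_entries_gt i.
have : (`I_i #= `I_k)%card by apply: card_eq_trans ck; rewrite card_eq_sym.
move/card_eq_II => <-; have := chain_heads_east ch cil cD i.
by rewrite c0.
Qed.
End Correspondence.

(** * Weights *)

Definition cells (t : tile) (D : tiling) := [set kj : nat * int | D kj.1 kj.2 = t].

Lemma cells_tcons t R D : cells t (tcons R D) =
  (pair 0%N @` [set j | R j = t]) `|` ((fun kj => (kj.1.+1, kj.2)) @` cells t D).
Proof.
apply/seteqP; split=> [[[|k] j] /= e|[k j] /=].
- by left; exists j.
- by right; exists (k, j).
- by case=> [[j' /= e [<- <-]]|[[k' j'] /= e [<- <-]]].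
Qed.

Lemma fsbig_tcons t R D (F : nat -> int -> series) :
  finite_set [set j | R j = t] -> finite_set (cells t D) ->
  \big[*%R/1]_(kj \in cells t (tcons R D)) F kj.1 kj.2 =
  (\big[*%R/1]_(j \in [set j | R j = t]) F 0%N j) *
  (\big[*%R/1]_(kj \in cells t D) F kj.1.+1 kj.2).
Proof.
move=> f1 f2; rewrite cells_tcons fsbigU0; try exact: finite_image.
  congr (_ * _).
    by rewrite fsbig_image // => j j' _ _ [].
  by rewrite fsbig_image // => -[k j] [k' j'] _ _ [-> ->].
by move=> kj [[j _ <-] [[k' j'] _]].
Qed.

Definition wt_empty (r k : nat) (j : int) : series := - omx (- (r + k)%N%:Z) j.
Definition wt_NW (r k : nat) (j : int) : series := 1 - omx (- (r + k)%N%:Z) j.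

Definition wtr (r : nat) (D : tiling) : series :=
  (\big[*%R/1]_(kj \in cells Defs.Empty D) wt_empty r kj.1 kj.2) *
  (\big[*%R/1]_(kj \in cells NWelbow D) wt_NW r kj.1 kj.2).

Lemma wtE D : wt D = wtr 0 D.
Proof.
have E1 : \big[*%R/1]_(kj \in cells Defs.Empty D)
    (- ominus (xvar (- kj.1%:Z)) (avar kj.2)) =
    \big[*%R/1]_(kj \in cells Defs.Empty D) wt_empty 0 kj.1 kj.2.
  by apply: eq_fsbigr => kj _; rewrite /wt_empty add0n ominusE.
have E2 : \big[*%R/1]_(kj \in cells NWelbow D)
    (1 - ominus (xvar (- kj.1%:Z)) (avar kj.2)) =
    \big[*%R/1]_(kj \in cells NWelbow D) wt_NW 0 kj.1 kj.2.
  by apply: eq_fsbigr => kj _; rewrite /wt_NW add0n ominusE.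
exact: congr2 E1 E2.
Qed.

Lemma wtr_tcons r R D :
  finite_set [set j | R j = Defs.Empty] -> finite_set [set j | R j = NWelbow] ->
  finite_set (cells Defs.Empty D) -> finite_set (cells NWelbow D) ->
  wtr r (tcons R D) =
  ((\big[*%R/1]_(j \in [set j | R j = Defs.Empty]) wt_empty r 0 j) *
   (\big[*%R/1]_(j \in [set j | R j = NWelbow]) wt_NW r 0 j)) * wtr r.+1 D.
Proof.
move=> f1 f2 f3 f4.
have E1 : \big[*%R/1]_(kj \in cells Defs.Empty D) wt_empty r kj.1.+1 kj.2 =
          \big[*%R/1]_(kj \in cells Defs.Empty D) wt_empty r.+1 kj.1 kj.2.
  by apply: eq_fsbigr => kj _; rewrite /wt_empty addnS.
have E2 : \big[*%R/1]_(kj \in cells NWelbow D) wt_NW r kj.1.+1 kj.2 =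
          \big[*%R/1]_(kj \in cells NWelbow D) wt_NW r.+1 kj.1 kj.2.
  by apply: eq_fsbigr => kj _; rewrite /wt_NW addnS.
rewrite /wtr (fsbig_tcons (wt_empty r) f1 f3) (fsbig_tcons (wt_NW r) f2 f4) E1 E2.
exact: mulrACA.
Qed.

(* The variables of the finite formula in m rows, shifted by -m. *)
Definition yvar (m k : nat) : series := 1 - xv (k%:Z - m%:Z).
Definition bvar (m c : nat) : series := ainv (c%:Z - m%:Z).

Section RowWeight.
Variables (lam nu : nat -> nat) (r M : nat) (R : int -> tile).
Hypotheses (dec : noninc lam) (lam_nu : il lam nu) (rowR : isrow lam nu r R).
Hypotheses (lam_supp : forall i, (M < i)%N -> lam i = 0%N).

Let box (i j : nat) : int := j%:Z - i%:Z - 1 - r%:Z.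

Definition row_empties : seq int :=
  [seq box i j | i <- index_iota 0 M.+1, j <- index_iota (nu i).+1 (lam i).+1].

Definition row_NWs : seq int :=
  [seq pos nu r.+1 i | i <- [seq i <- index_iota 0 M.+1 | (lam i.+1 < nu i)%N]].

Lemma row_emptiesE : [set j | R j = Defs.Empty] = [set` row_empties].
Proof.
apply/seteqP; split=> j /=.
  move/(isrow_emptyP dec lam_nu rowR) => [i hi]; apply/allpairsPdep => /=.
  have iM : (i <= M)%N.
    rewrite leqNgt; apply/negP => /lam_supp li.
    by move: hi (lam_nu i); rewrite /pos li; lia.
  exists i, (absz (j + i%:Z + 1 + r%:Z)%R); split.
  - by rewrite mem_index_iota; lia.
  - by rewrite mem_index_iota; move: hi; rewrite /pos; lia.
  - by rewrite /box; move: hi; rewrite /pos; lia.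
move/allpairsPdep => [i [k [_ ]]]; rewrite mem_index_iota => hk ->.
by apply/(isrow_emptyP dec lam_nu rowR); exists i; move: hk; rewrite /box /pos; lia.
Qed.

Lemma uniq_row_empties : uniq row_empties.
Proof.
apply: allpairs_uniq_dep; first exact: iota_uniq.
  by move=> i _; exact: iota_uniq.
move=> _ _ /allpairsPdep[i [j [_ hj ->]]] /allpairsPdep[i' [j' [_ hj' ->]]] /= e.
rewrite !mem_index_iota in hj hj'.
have ii : i = i'.
  have [lt|lt|//] := ltngtP i i'.
    have := noninc_le dec lt; have := lam_nu i; move: e hj hj'; rewrite /box; lia.
  have := noninc_le dec lt; have := lam_nu i'; move: e hj hj'; rewrite /box; lia.
subst i'; have -> : j = j' by move: e; rewrite /box; lia.
by [].
Qed.

Lemma row_NWsE : [set j | R j = NWelbow] = [set` row_NWs].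
Proof.
apply/seteqP; split=> j /=.
  move/(isrow_NWP dec lam_nu rowR) => [i lt ->]; apply/mapP; exists i => //.
  rewrite mem_filter lt mem_index_iota /= ltnS leqNgt; apply/negP => /lam_supp li.
  by have := lam_nu i; rewrite li; lia.
move=> /mapP[i]; rewrite mem_filter => /andP[lt _] ->.
by apply/(isrow_NWP dec lam_nu rowR); exists i.
Qed.

Lemma uniq_row_NWs : uniq row_NWs.
Proof.
rewrite map_inj_uniq ?filter_uniq ?iota_uniq //.
exact: pos_inj (il_noninc lam_nu).
Qed.

Let big_empties (f : int -> series) :
  \big[*%R/1]_(j \in [set j | R j = Defs.Empty]) f j =
  \prod_(i < M.+1) \prod_((nu i).+1 <= j < (lam i).+1) f (box i j).
Proof.
rewrite row_emptiesE -fsbig_seq; last exact: uniq_row_empties.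
by rewrite /row_empties big_allpairs_dep big_mkord.
Qed.

Let big_NWs (f : int -> series) :
  \big[*%R/1]_(j \in [set j | R j = NWelbow]) f j =
  \prod_(i < M.+1) (if (lam i.+1 < nu i)%N then f (pos nu r.+1 i) else 1).
Proof.
rewrite row_NWsE -fsbig_seq; last exact: uniq_row_NWs.
by rewrite /row_NWs big_map big_filter big_mkcond big_mkord.
Qed.

(** Shifting by m = M + 1 + r turns the column j - i - 1 - r of an empty tile into the index j + M -
    i of the finite formula, and row -r into the variable of index M + 1. *)
Lemma row_weight m : m = (M.+1 + r)%N ->
  (\big[*%R/1]_(j \in [set j | R j = Defs.Empty]) wt_empty r 0 j) *
  (\big[*%R/1]_(j \in [set j | R j = NWelbow]) wt_NW r 0 j) =
  (-1) ^+ (\sum_(i < M.+1) (lam i - nu i)) * strip_wt (yvar m) (bvar m) M lam nu.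
Proof.
move=> mE; rewrite big_empties big_NWs -big_split /=.
rewrite -prodrXr /strip_wt -big_split /=; apply: eq_bigr => i _.
have yE : yvar m M.+1 = 1 - xv (- r%:Z) by rewrite /yvar; congr (1 - xv _); lia.
have iM := ltn_ord i; rewrite /strip_wt1 mulrA; apply: congr2.
  have -> : (lam i - nu i = (lam i).+1 - (nu i).+1)%N by rewrite subSS.
  rewrite -prodr_const_nat -big_split /=; apply: eq_big_nat => j hj.
  rewrite mulN1r /fac yE /wt_empty addn0 /bvar.
  by have -> : (j + M - i)%N%:Z - m%:Z = box i j by rewrite /box; lia.
rewrite /wt_NW addn0 yE /bvar.
have -> : (nu i + M - i)%N%:Z - m%:Z = pos nu r.+1 i by rewrite /pos; lia.
by rewrite subKr.
Qed.

Lemma row_finite : finite_set [set j | R j = Defs.Empty] /\ finite_set [set j | R j = NWelbow].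
Proof. by rewrite row_emptiesE row_NWsE; split; exact: finite_seq. Qed.
End RowWeight.

Lemma ground_isrow r k : isrow (fun=> 0%N) (fun=> 0%N) (r + k) (ground r k).
Proof. exact: row_isrow. Qed.

Lemma ground_empty r : cells Defs.Empty (ground r) = set0.
Proof.
have h0 : noninc (fun=> 0%N) by []; have il0 : il (fun=> 0%N) (fun=> 0%N) by [].
apply/seteqP; split=> // -[k j] /= e.
have [i] := (isrow_emptyP h0 il0 (ground_isrow r k) j).1 e.
by rewrite /pos; lia.
Qed.

Lemma ground_NW r : cells NWelbow (ground r) = set0.
Proof.
have h0 : noninc (fun=> 0%N) by []; have il0 : il (fun=> 0%N) (fun=> 0%N) by [].
apply/seteqP; split=> // -[k j] /= e.
by have [i] := (isrow_NWP h0 il0 (ground_isrow r k) j).1 e.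
Qed.

Lemma tilings_finite B M lam r D : noninc lam -> (forall i, (M <= i)%N -> lam i = 0%N) ->
  D \in tilings B M lam r ->
  finite_set (cells Defs.Empty D) /\ finite_set (cells NWelbow D).
Proof.
elim: M lam r D => [|M IH] lam r D h supp.
  by rewrite inE => /eqP ->; rewrite ground_empty ground_NW.
case/tilingsS => nu nuP [D' D'P ->]; have lam_nu := strip_il supp nuP.
have [f1 f2] := row_finite h lam_nu (row_isrow (ffext nu) r h) supp.
have [|f3 f4] := IH (ffext nu) r.+1 D' (il_noninc lam_nu) _ D'P.
  by move=> i Mi; rewrite ffext_out.
by rewrite !cells_tcons; split; rewrite finite_setU; split; exact: finite_image.
Qed.

(** A row with partitions lam and nu has |lam| - |nu| empty tiles. These numbers telescope to |lam|,
    so the sign is the same for all tilings in the list. *)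
Lemma tilings_sum B M lam r m : m = (M + r)%N -> noninc lam -> (lam 0 <= B)%N ->
  (forall i, (M <= i)%N -> lam i = 0%N) ->
  \sum_(D <- tilings B M lam r) wtr r D =
  (-1) ^+ (\sum_(i < M) lam i) * gt_sum (yvar m) (bvar m) B M lam.
Proof.
elim: M lam r => [|M IH] lam r mE h lamB supp.
  rewrite big_ord0 expr0 mul1r /= big_seq1 /wtr ground_empty ground_NW.
  by rewrite !fsbig_set0 mulr1.
rewrite [tilings _ _ _ _]/= big_allpairs_dep big_enum /= mulr_sumr.
apply: eq_bigr => nu nuP; have lam_nu := strip_il supp nuP.
have nu_h := il_noninc lam_nu.
have nu0 i : (M <= i)%N -> ffext nu i = 0%N by move=> Mi; rewrite ffext_out.
have rowR := row_isrow (ffext nu) r h.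
have [f1 f2] := row_finite h lam_nu rowR supp.
pose W := (-1) ^+ (\sum_(i < M.+1) (lam i - ffext nu i)) *
  strip_wt (yvar m) (bvar m) M lam (ffext nu).
rewrite (eq_big_seq (fun D => W * wtr r.+1 D)); last first.
  move=> D /(tilings_finite nu_h nu0)[f3 f4].
  by rewrite wtr_tcons // (row_weight h lam_nu rowR supp mE).
rewrite -mulr_sumr IH //; last 2 first.
- by rewrite mE addSnnS.
- by have := lam_nu 0%N; lia.
have -> : (\sum_(i < M.+1) lam i = \sum_(i < M.+1) (lam i - ffext nu i) + \sum_(i < M) ffext nu i)%N.
  have -> : (\sum_(i < M) ffext nu i = \sum_(i < M.+1) ffext nu i)%N.
    by rewrite [RHS]big_ord_recr /= nu0 // addn0.
  rewrite -big_split /=; apply: eq_bigr => i _.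
  by have := lam_nu i; lia.
by rewrite exprD /W mulrACA.
Qed.

(** * Grassmannian Grothendieck polynomials *)

Lemma ren_gt_sum r (Y b : nat -> series) B M lam : bijective r ->
  ren r (gt_sum Y b B M lam) = gt_sum (fun k => ren r (Y k)) (fun c => ren r (b c)) B M lam.
Proof.
move=> rb; elim: M lam => [|M IH] lam; first by rewrite /= (ren1 _ rb).
rewrite /= (ren_sum _ _ _ rb); apply: eq_bigr => nu _.
rewrite (renM _ _ rb) IH; congr (_ * _).
rewrite /strip_wt (ren_prod _ _ _ rb); apply: eq_bigr => i _.
rewrite /strip_wt1 (renM _ _ rb); congr (_ * _).
  rewrite (ren_prod _ _ _ rb); apply: eq_bigr => j _.
  by rewrite /fac (renB _ _ rb) (ren1 _ rb) (renM _ _ rb).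
by case: ifP => _; [exact: renM|exact: ren1].
Qed.

Lemma shift_var_bij k : bijective (shift_var k).
Proof.
by exists (shift_var (- k)) => -[i|i]; rewrite /= ?addrK ?subrK ?addrNK.
Qed.

Lemma code_id n i : code n id i = 0%N.
Proof.
rewrite /code /countlt big_nat big1 // => j /andP[ij _].
by case: ltP => //; lia.
Qed.

Lemma groth_id n F : is_groth n id F -> F = 1.
Proof.
move=> gF; have dom : dominant n id by move=> i _; rewrite !code_id.
rewrite (groth_uniq gF (groth_dominant (@inS_id n) dom)) /domprod big1 // => i _.
by rewrite code_id /boxes big_geq.
Qed.

Section GrassmannianGroth.
Variables (lam : seq nat) (lam_part : is_partition lam) (m : nat).
Hypothesis m_large : (size lam <= m)%N.
Local Notation l := (fun i => nth 0%N lam i).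
Local Notation w := (w_part lam).
Let v := gamma m%:Z w.

Let vE (i : nat) : v (m%:Z - i%:Z) = (l i)%:Z - i%:Z + m%:Z.
Proof. by rewrite /v /gamma addrAC subrr add0r w_part_opp. Qed.

Let vE' (j : int) : j <= m%:Z -> v j = (l (absz (m%:Z - j)))%:Z + j.
Proof. by move=> jm; have := vE (absz (m%:Z - j)); rewrite (_ : m%:Z - _ = j); lia. Qed.

Let v_inc1 (j k : int) : 1 <= j -> j < k -> k <= m%:Z -> v j < v k.
Proof.
move=> j1 jk km; rewrite !vE'; try lia.
have jk' : (absz (m%:Z - k) <= absz (m%:Z - j))%N by lia.
by have := nth_partition_anti lam_part jk'; lia.
Qed.

Let v_inc2 (j k : int) : m%:Z < j -> j < k -> v j < v k.
Proof.
move=> mj jk; rewrite /v /gamma ltrD2r.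
have step (n : nat) : w (j - m%:Z) < w (j - m%:Z + n.+1%:Z).
  elim: n => [|n IH]; first by apply: w_part_ascent => //; lia.
  apply: lt_trans IH _; have := @w_part_ascent lam lam_part (j - m%:Z + n.+1%:Z).
  have -> : j - m%:Z + n.+1%:Z + 1 = j - m%:Z + n.+2%:Z by lia.
  by apply; lia.
have := step (absz (k - j - 1)%R).
by have -> : j - m%:Z + (absz (k - j - 1)%R).+1%:Z = k - m%:Z by lia.
Qed.

Lemma gamma_inS : inS (m + l 0)%N v.
Proof.
split=> [j k|j jn].
  by move/addIr/(bij_inj (w_part_bij lam))/addIr.
have [jm|jm] := leP j m%:Z.
  by rewrite vE' // nth_default ?add0r //; lia.
by rewrite /v /gamma w_part_large ?subrK //; lia.
Qed.

Lemma groth_gamma_large n F : (m <= n)%N -> is_groth n v F ->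
  F = gt_sum (fun k => 1 - xv k%:Z) (fun c => ainv c%:Z) (l 0) m l.
Proof.
move=> mn gF; apply: (@lreg_xdelta m); rewrite mulrC.
pose c i := (l i + (m - i.+1))%N.
rewrite (@groth_grassmannian n m v F c (groth_inS gF) mn v_inc1 v_inc2 _ gF); last first.
  move=> i im; have -> : (m - i)%N%:Z = m%:Z - i%:Z by lia.
  by rewrite vE /c; lia.
have -> : xdelta m = ydelta (fun k => 1 - xv k%:Z) m.
  by apply: eq_bigr => i _; apply: eq_bigr => j _; ring.
rewrite mulrC gt_sum_det //.
- move=> k; exact: lreg_1sub_var.
- move=> k j; exact: lreg_omx.
- exact: part_noninc.
Qed.

(** The value of [groth] may come from any S_n containing v. If n < m, then v fixes m, which forces
    lam to be empty and v = id; that case is compared directly. *)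
Lemma groth_gamma : groth v =
  gt_sum (fun k => 1 - xv k%:Z) (fun c => ainv c%:Z) (l 0) m l.
Proof.
have [F0 g0] := groth_exists gamma_inS.
rewrite /groth; case: xgetP => [F _ /= [n gF]|/(_ F0)]; last by case; exists (m + l 0)%N.
have [mn|nm] := leqP m n; first exact: groth_gamma_large gF.
have l0 : l 0%N = 0%N.
  have [_ /(_ m%:Z)] := groth_inS gF; rewrite vE' // subrr /=; lia.
have li i : l i = 0%N by have := nth_partition_anti lam_part (leq0n i); rewrite l0; lia.
have vid : v = id.
  apply/funext => j; have [jm|jm] := leP j m%:Z; first by rewrite vE' // li add0r.
  by rewrite /v /gamma w_part_large ?subrK // l0; lia.
have E := groth_gamma_large (leq_addr _ _) g0.
by rewrite vid in g0 gF; rewrite (groth_id gF) -E (groth_id g0).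
Qed.

Lemma groth_gamma_shift :
  mps_rename (shift_var (- m%:Z)) (groth v) = gt_sum (yvar m) (bvar m) (l 0) m l.
Proof.
have b := shift_var_bij (- m%:Z).
have -> : mps_rename (shift_var (- m%:Z)) (groth v) = ren (shift_var (- m%:Z)) (groth v).
  by rewrite ren.unlock.
have E1 : (fun k : nat => ren (shift_var (- m%:Z)) (1 - xv k%:Z)) = yvar m.
  by apply/funext => k; rewrite (renB _ _ b) (ren1 _ b) (ren_var _ _ b).
have E2 : (fun c : nat => ren (shift_var (- m%:Z)) (ainv c%:Z)) = bvar m.
  by apply/funext => c; rewrite (ren_geo _ _ b).
by rewrite groth_gamma (ren_gt_sum _ _ _ _ _ b) E1 E2.
Qed.
End GrassmannianGroth.

(** * Coefficients *)

Lemma mpcoefM_eq0 (f : series) (a b : (int + int)%type)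
    (mon : {cmonom (int + int)%type}) : mon a = 0%N -> mon b = 0%N ->
  ((pvar int a - pvar int b) * f) mon = 0.
Proof.
by move=> ma mb; rewrite mulrC mulrBr mpcoefB !mpcoefM_var0 ?subr0.
Qed.

Lemma cmonom_bounded (mon : {cmonom (int + int)%type}) :
  exists T : nat, forall i : int, i <= - T%:Z -> mon (inl i) = 0%N /\ mon (inr i) = 0%N.
Proof.
pose a (u : int + int) : nat := match u with inl i => absz i | inr i => absz i end.
exists (\sum_(u <- finsupp mon) (a u).+1).+1 => i hi.
have key u : i = (match u with inl i => i | inr i => i end) -> mon u = 0%N.
  move=> iE; apply/eqP; rewrite cmE_eq0; apply/negP => um.
  have : (a u < \sum_(u <- finsupp mon) (a u).+1)%N.
    by rewrite (big_fsetD1 u um) /= ltnS leq_addr.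
  move: hi; move: (\sum_(_ <- _) _)%N => S hi.
  by move: iE; rewrite /a; case: u {um} => z iE lt; lia.
by split; apply: key.
Qed.

Lemma mpcoef_sign n (f : series) mon : ((-1) ^+ n * f) mon = (-1) ^+ n * f mon.
Proof.
elim: n => [|n IH]; first by rewrite !expr0 !mul1r.
by rewrite !exprS -!mulrA !mulN1r mpcoefN IH.
Qed.

(** * Stabilization of coefficients and the limit *)

Section Conclusion.
Variables (lam : seq nat) (lam_part : is_partition lam).
Local Notation l := (fun i => nth 0%N lam i).
Let h := part_noninc lam_part.

Lemma hp_cells_finite D : halfplane_pipedream lam D ->
  finite_set (cells Defs.Empty D) /\ finite_set (cells NWelbow D).
Proof.
case=> _ _ _ _ _ _ fin; split; apply: sub_finite_set fin => kj /= e; by [left|right].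
Qed.

Lemma tilings_halfplane M D : (size lam <= M)%N -> D \in tilings (l 0) M l 0 ->
  halfplane_pipedream lam D.
Proof.
move=> lM DP; have supp i : (M <= i)%N -> l i = 0%N.
  by move=> Mi; rewrite nth_default // (leq_trans lM).
apply: (tilings_hp lam_part lM DP); have [f1 f2] := tilings_finite h supp DP.
have -> : [set kj : nat * int | D kj.1 kj.2 = Defs.Empty \/ D kj.1 kj.2 = NWelbow] =
  cells Defs.Empty D `|` cells NWelbow D by [].
by rewrite finite_setU.
Qed.

(* A pipedream outside the list has an empty tile far north, hence far west. *)
Lemma wt_coef_eq0 mon : exists M0, forall M D, (M0 <= M)%N ->
  halfplane_pipedream lam D -> D \notin tilings (l 0) M l 0 -> wt D mon = 0.
Proof.
have [T HT] := cmonom_bounded mon.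
exists (size lam + T + l 0)%N => M D hM hpD DN.
have pt := hp_pipe_tiling lam_part hpD; have [f1 f2] := hp_cells_finite hpD.
have [N HN] : exists N, forall k j, (N <= k)%N -> D k j <> NWelbow.
  have /finite_fsetP[X XE] : finite_set (fst @` cells NWelbow D).
    exact: finite_image.
  exists (\sum_(k <- X) k).+1 => k j Nk e.
  have kX : k \in X by have : [set` X] k by rewrite -XE; exists (k, j).
  by move: Nk; rewrite (big_fsetD1 k kX) /=; lia.
(* For k >= T + lam_0 both -k and j are at most -T, because empty tiles of row -k lie in columns
   below lam_0 - k. Hence neither x_(-k) nor a_j occurs in the monomial. *)
have [k [j [hk e]]] : exists k j, (T + l 0 <= k)%N /\ D k j = Defs.Empty.
  apply: contrapT => no; move/negP: DN; apply.
  apply: (@pipe_tiling_tilings (l 0) (T + l 0) (size lam)) => //.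
  - by move=> i; exact: nth_default.
  - by move=> k j hk e; apply: no; exists k, j.
  - by exists N.
  - by rewrite addnC addnA.
have jb := pipe_tiling_empty_bound h pt e.
have cE : cells Defs.Empty D (k, j) by [].
have E : wt_empty 0 k j = (xv (- k%:Z) - av j) * - ainv j.
  by rewrite /wt_empty add0n omx_fact mulrN.
rewrite wtE /wtr (fsbigD1 (k, j) _ _ f1 cE) [(k, j).1]/= [(k, j).2]/= E -!mulrA.
rewrite mpcoefM_eq0 //.
  by case: (HT (- k%:Z)) => //; lia.
by case: (HT j) => //; lia.
Qed.

Lemma mps_sum_coef mon : exists2 M0, (size lam <= M0)%N & forall M, (M0 <= M)%N ->
  mps_sum (halfplane_pipedream lam) wt mon =
  (\sum_(D <- tilings (l 0) M l 0) wt D) mon.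
Proof.
have [M0 HM0] := wt_coef_eq0 mon.
exists (maxn (size lam) M0); first exact: leq_maxl.
move=> M; rewrite geq_max => /andP[lM hM]; rewrite mpcoef_sum.
have supp i : (M <= i)%N -> l i = 0%N.
  by move=> Mi; rewrite nth_default // (leq_trans lM).
rewrite [RHS]fsbig_seq; last exact: uniq_tilings.
apply/esym; apply: fsbig_widen => D /=; first exact: tilings_halfplane.
by move=> [hpD DN]; apply: (HM0 M) => //; apply/negP.
Qed.

Lemma sum_nth_sumn M : (size lam <= M)%N -> (\sum_(i < M) l i = sumn lam)%N.
Proof.
move=> lM; rewrite sumnE (big_nth 0%N) -(big_mkord xpredT l) (@big_cat_nat _ _ _ (size lam)) //=.
have -> : (\sum_(size lam <= i < M) nth 0%N lam i = 0)%N.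
  by rewrite big_nat big1 // => i /andP[i1 _]; rewrite nth_default.
by rewrite addn0.
Qed.

Lemma hp_summable : mps_summable (halfplane_pipedream lam) wt.
Proof.
move=> mon; have [M0 HM0] := wt_coef_eq0 mon.
apply: (@sub_finite_set _ _ [set` tilings (l 0) M0 l 0]); last exact: finite_seq.
move=> D /= [hpD]; apply: contraNT => DN; apply/eqP; exact: HM0 (leqnn _) hpD DN.
Qed.

Lemma G_part_hp : G_part lam = (-1) ^+ sumn lam * mps_sum (halfplane_pipedream lam) wt.
Proof.
rewrite /G_part /backstable_groth /mps_lim_mninfty.
set u := fun p : int => _; set S := _ * _.
have cvS : mps_cvg_mninfty u S.
  move=> mon; have [M0 lM0 HM0] := mps_sum_coef mon.
  exists (1 - M0%:Z) => p hp; pose M := absz (1 - p).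
  have ME : 1 - p = M%:Z by rewrite /M; lia.
  have M0M : (M0 <= M)%N by rewrite /M; lia.
  have lM := leq_trans lM0 M0M.
  rewrite /S mpcoef_sign (HM0 M M0M) -mpcoef_sign.
  have -> : u p = gt_sum (yvar M) (bvar M) (l 0) M l.
    rewrite /u ME; have -> : p - 1 = - M%:Z by rewrite -ME; ring.
    exact: groth_gamma_shift.
  rewrite (eq_bigr (wtr 0)); last by move=> D _; exact: wtE.
  rewrite (@tilings_sum _ _ _ _ M) ?addn0 //; last first.
    by move=> i Mi; rewrite nth_default // (leq_trans lM).
  by rewrite (sum_nth_sumn lM) mulrA -exprD addnn -signr_odd odd_double expr0 mul1r.
(* The limit is a chosen one; two limits agree at each coefficient once p is below both
   thresholds. *)
case: xgetP => [S' _ /= cvS'|/(_ S)//].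
apply: mpseriesP => mon; have [P HP] := cvS mon; have [P' HP'] := cvS' mon.
by rewrite -(HP (Num.min P P')) -?(HP' (Num.min P P')) // ge_min lexx ?orbT.
Qed.
End Conclusion.

Theorem theorem6p5 (lam : seq nat) (lam_part : is_partition lam) :
  mps_summable (halfplane_pipedream lam) wt /\
  G_part lam = (-1) ^+ sumn lam * mps_sum (halfplane_pipedream lam) wt.
Proof. exact: conj (hp_summable lam_part) (G_part_hp lam_part). Qed.
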